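(* Let $S$ be an operator system with state space $L$ (with the weak-$*$ topology). Let $\Gamma\subset C(L)$ denote the closed cone of continuous convex (real-valued) functions on $L$. Let $\varepsilon:S\to C(L)$ be the evaluation map $[\varepsilon(s)](\phi)=\phi(s)$, let $(C^*_{\max}(S),j)$ be the maximal $C^*$-cover of $S$, and let $q:C^*_{\max}(S)\to C(L)$ denote the surjective unital $*$-homomorphism satisfying $q\circ j=\varepsilon$ on $S$. Let $\Xi\subset C^*_{\max}(S)$ be the cone defined in the context. Then $q(\Xi)\subset\Gamma$, and $q(\Xi)$ contains all restrictions to $L$ of real-valued affine weak-$*$ continuous functions on $S^*$. Furthermore, $\Gamma$ is the smallest closed cone of $C(L)$ that is stable under maxima and contains $q(\Xi)$.
   Context: Maximal $C^*$-cover: a $C^*$-cover of an operator system $S$ is a pair $(B,\theta)$ where $B$ is a unital $C^*$-algebra and $\theta:S\to B$ is a unital complete isometry with $B=C^*(\theta(S))$. There is a maximal one $(C^*_{\max}(S),j)$: for any $C^*$-cover $(B,\theta)$ there is a surjective unital $*$-homomorphism $\pi:C^*_{\max}(S)\to B$ with $\pi\circ j=\theta$. Moreover every unital completely positive map $\phi:S\to B(H)$ has a unique unital $*$-representation $\widehat\phi:C^*_{\max}(S)\to B(H)$ with $\widehat\phi\circ j=\phi$; the same holds for unital completely contractive maps into a unital $C^*$-algebra such as $C(L)$. A cone of real-valued functions is a subset closed under sums and nonnegative scalar multiples; it is stable under maxima if it contains the pointwise maximum of any two of its elements. The cone $\Xi$: let $\kappa$ be an infinite cardinal greater than the linear dimension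 of $S$. For each cardinal $1\le n\le\kappa$ fix a Hilbert space $H_n$ of dimension $n$ (with $H_1=\mathbb{C}$), and let $K_n$ be the set of unital completely positive maps $S\to B(H_n)$ (so $K_1=L$); $K=(K_n)_{n\le\kappa}$. For a cardinal $m\le\kappa$ fix an index set $I_m$ of cardinality $m$, and let $\mathbb{M}_m(B(H_n))=B(\bigoplus_{i\in I_m}H_n)$, whose elements are written as $I_m\times I_m$ matrices. An nc function $F:K\to\mathbb{M}_m(\mathbb{C})$ is a family of functions $F_n:K_n\to\mathbb{M}_m(B(H_n))$, $n\le\kappa$, that respects direct sums, i.e. $F_n(\sum_i\alpha_i x_i\alpha_i^* )=\sum_i(1_m\otimes\alpha_i)F_{n_i}(x_i)(1_m\otimes\alpha_i^* )$ whenever $x_i\in K_{n_i}$ and $\alpha_i:H_{n_i}\to H_n$ are isometries with $\sum_i\alpha_i\alpha_i^*=1$, and is unitarily equivariant, i.e. $F_n(\beta x\beta^* )=(1_m\otimes\beta)F_n(x)(1_m\otimes\beta^* )$ for $x\in K_n$ and unitary $\beta\in B(H_n)$. Its entries $F^{(i,j)}:K\to\mathbb{C}$ ($i,j\in I_m$) are scalar-type nc functions with $F^{(i,j)}_n:K_n\to B(H_n)$. An nc function $f:K\to\mathbb{C}$ is continuous if each $f_n:K_n\to B(H_n)$ is continuous when $K_n$ carries the topology of pointwise $\sigma$-strong$^*$ convergence and $B(H_n)$ the $\sigma$-strong$^*$ topology; $F$ is continuous if all its entries are. The continuous nc functions $K\to\mathbb{C}$ form a unital $C^*$-algebra $\mathcal{A}$,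 and there is a $*$-isomorphism $\Phi:C^*_{\max}(S)\to\mathcal{A}$ with $[\Phi(b)]_n(\phi)=\widehat\phi(b)$ for $\phi\in K_n$. A self-adjoint nc function $F$ is convex if $F_n(t\phi+(1-t)\psi)\le tF_n(\phi)+(1-t)F_n(\psi)$ for all $n\le\kappa$, $\phi,\psi\in K_n$, $0\le t\le1$. Finally, $\Xi\subset C^*_{\max}(S)$ is the set of all elements $\sum_{i,j\in I}c_j\overline{c_i}\,\Phi^{-1}(F^{(i,j)})$, where $F:K\to\mathbb{M}_m(\mathbb{C})$ is a (self-adjoint) convex continuous nc function for some cardinal $m\le\kappa$, $I\subset I_m$ is finite, and $c_i\in\mathbb{C}$ for $i\in I$. *)

(* Defs.v *)
From HB Require Import structures.
From mathcomp Require Import all_boot all_order all_algebra finmap complex.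
From mathcomp Require Import all_classical all_reals all_analysis.
From mathcomp Require Import sesquilinear.
From mathcomp.analysis.showcase Require summability.
Import Order.TTheory GRing.Theory Num.Theory numFieldNormedType.Exports.

Set Implicit Arguments.
Unset Strict Implicit.
Unset Printing Implicit Defensive.
Local Open Scope classical_set_scope.
Local Open Scope complex_scope.
Local Open Scope ring_scope.

(* The scalars are R[i]; the library's topology on them is carried by R[i]^o.
   Norms are R[i]-valued, and x <= y in R[i] means that y - x is a nonnegative
   real. *)

(* The inner product is linear in its first argument. *)
HB.mixin Record isHilbert (R : realType) H & CompleteNormedModule R[i] H := {
  inner : {dot H for (@Num.conj R[i])} ;
  hnormE : forall x : H, `|x| ^+ 2 = (inner : H -> H -> R[i]) x x }.

#[short(type="hilbertType")]
HB.structure Definition Hilbert (R : realType) :=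
  {H of isHilbert R H & CompleteNormedModule R[i] H}.

Definition ip (R : realType) (H : hilbertType R) (x y : H) : R[i] :=
  (@inner R H : H -> H -> R[i]) x y.

Section Operators.
Variable R : realType.
Implicit Types H K : hilbertType R.

(* Operators are plain functions; linear combinations are those of the
   pointwise module structure on H -> K. *)
Definition bounded_op H K : set (H -> K) :=
  [set T | linear T /\ continuous T].

Definition adjoint_of H K (T : H -> K) (U : K -> H) :=
  forall x y, ip (T x) y = ip x (U y).

(* By the Riesz theorem every bounded operator has exactly one bounded
   adjoint; the default value is irrelevant for bounded T. *)
Definition adj H K (T : H -> K) : K -> H :=
  xget (fun=> 0) [set U | bounded_op U /\ adjoint_of T U].

Definition op_le H (T U : H -> H) := forall x, 0 <= ip (U x - T x) x.

Definition isometry_op H K (T : H -> K) :=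
  linear T /\ forall x, `|T x| = `|x|.

Definition unitary_op H (T : H -> H) :=
  isometry_op T /\ set_surj setT setT T.

(* Unordered (net over finite subsets) strong-operator sum. *)
Definition op_sum (J : choiceType) H K (T : J -> H -> K) (U : H -> K) :=
  forall x, summability.partial_sum (fun i => T i x) @ summability.totally
            --> U x.

(* The second clause says that the orthonormal family e is maximal. *)
Definition orthonormal_basis (J : choiceType) H (e : J -> H) :=
  (forall i k, ip (e i) (e k) = (i == k)%:R) /\
  (forall x, (forall i, ip x (e i) = 0) -> x = 0).

(* D, with the embeddings [inj i], is the Hilbert space direct sum of copies of
   H indexed by J: the ranges of the isometries [inj i] are pairwise orthogonal
   and span a dense subspace.  This determines D up to a unitary. *)
Definition hilbert_sum (J : choiceType) H (D : hilbertType R)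
    (inj : J -> H -> D) :=
  [/\ forall i, linear (inj i),
      forall i k x y, ip (inj i x) (inj k y) = if i == k then ip x y else 0
    & forall d, (forall i x, ip d (inj i x) = 0) -> d = 0].

Definition sq_summable H (xi : nat -> H) :=
  exists M : R[i], forall N, \sum_(k < N) `|xi k| ^+ 2 <= M.

(* \sum_k (|T xi_k|^2 + |T^* xi_k|^2) <= e: these are the balls of the seminorms
   generating the sigma-strong* topology.  One sequence suffices for a basic
   neighbourhood, since finitely many sequences can be interleaved. *)
Definition sstar_small H (xi : nat -> H) (e : R[i]) (T : H -> H) :=
  forall N, \sum_(k < N) (`|T (xi k)| ^+ 2 + `|adj T (xi k)| ^+ 2) <= e.

Definition sstar_nbhs H (T : H -> H) : set_system (H -> H) :=
  [set A | exists xi e, [/\ sq_summable xi, 0 < e &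
    forall U, bounded_op U -> sstar_small xi e (U - T) -> A U]].

(* Trace on the set P of the topology of pointwise sigma-strong* convergence. *)
Definition ptws_sstar_nbhs (S : choiceType) H (P : set (S -> H -> H))
    (phi : S -> H -> H) : set_system (S -> H -> H) :=
  [set A | exists (X : {fset S}) xi e, [/\ sq_summable xi, 0 < e &
    forall psi, P psi ->
      (forall s, s \in X -> sstar_small xi e (psi s - phi s)) -> A psi]].

End Operators.

(* The multiplication is a field of the mixin because algType and normedModType
   cannot be joined in the library's hierarchy; the algebra structure is
   declared below. *)
HB.mixin Record isCStar (R : realType) A & CompleteNormedModule R[i] A := {
  cs_one : A ;
  cs_mul : A -> A -> A ;
  star : A -> A ;
  cs_mulA : associative cs_mul ;
  cs_mul1l : left_id cs_one cs_mul ;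
  cs_mul1r : right_id cs_one cs_mul ;
  cs_mulDl : left_distributive cs_mul +%R ;
  cs_mulDr : right_distributive cs_mul +%R ;
  cs_scaleAl : forall (a : R[i]) x y, a *: cs_mul x y = cs_mul (a *: x) y ;
  cs_scaleAr : forall (a : R[i]) x y, a *: cs_mul x y = cs_mul x (a *: y) ;
  cs_one_neq0 : cs_one != 0 ;
  starK : involutive star ;
  starD : {morph star : x y / x + y} ;
  starZ : forall (a : R[i]) x, star (a *: x) = Num.conj a *: star x ;
  cs_starM : forall x y, star (cs_mul x y) = cs_mul (star y) (star x) ;
  cs_normM : forall x y : A, `|cs_mul x y| <= `|x| * `|y| ;
  cs_norm_star : forall x : A, `|cs_mul (star x) x| = `|x| ^+ 2 }.

#[short(type="cstarType")]
HB.structure Definition CStar (R : realType) :=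
  {A of isCStar R A & CompleteNormedModule R[i] A}.

#[non_forgetful_inheritance]
HB.instance Definition _ (R : realType) (A : cstarType R) :=
  GRing.Zmodule_isNzRing.Build A
    (@cs_mulA R A) (@cs_mul1l R A) (@cs_mul1r R A)
    (@cs_mulDl R A) (@cs_mulDr R A) (@cs_one_neq0 R A).
#[non_forgetful_inheritance]
HB.instance Definition _ (R : realType) (A : cstarType R) :=
  GRing.Lmodule_isLalgebra.Build R[i] A (@cs_scaleAl R A).
#[non_forgetful_inheritance]
HB.instance Definition _ (R : realType) (A : cstarType R) :=
  GRing.Lalgebra_isAlgebra.Build R[i] A (@cs_scaleAr R A).

Section CStarTheory.
Variable R : realType.
Implicit Types A B : cstarType R.

Definition cpos A : set A := [set a | exists y, a = star y * y].

Definition mxstar A k (X : 'M[A]_k) : 'M[A]_k := (map_mx (@star R A) X)^T.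

(* The positive cone of the C*-algebra M_k(A). *)
Definition mxpos A k : set 'M[A]_k :=
  [set X | exists Y, X = mxstar Y *m Y].

Record is_cstar_mxnorm A k (N : 'M[A]_k -> R[i]) : Prop := {
  mxnormD : forall X Y, N (X + Y) <= N X + N Y ;
  mxnormZ : forall a X, N (map_mx ( *:%R a) X) = `|a| * N X ;
  mxnorm0_eq0 : forall X, N X = 0 -> X = 0 ;
  mxnormM : forall X Y, N (X *m Y) <= N X * N Y ;
  mxnorm_star : forall X, N (mxstar X *m X) = N X ^+ 2 }.

(* The *-algebra M_k(A) has exactly one C*-norm. *)
Definition cstar_mxnorm A k : 'M[A]_k -> R[i] :=
  xget (fun=> 0) [set N | is_cstar_mxnorm N].

Definition cstar_generates A (E : set A) :=
  forall D : set A, closed D -> E `<=` D ->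
    (forall x y, D x -> D y -> D (x + y)) ->
    (forall x y, D x -> D y -> D (x * y)) ->
    (forall (a : R[i]) x, D x -> D (a *: x)) ->
    (forall x, D x -> D (star x)) ->
  D = setT.

Record is_star_rep A (H : hilbertType R) (pi : A -> H -> H) : Prop := {
  rep_linear : linear pi ;
  rep_bounded : forall a, bounded_op (pi a) ;
  rep1 : pi 1 = id ;
  repM : forall a b, pi (a * b) = pi a \o pi b ;
  rep_star : forall a, adjoint_of (pi a) (pi (star a)) }.

End CStarTheory.

(* A vector space identified, through [os_emb], with a unital self-adjoint
   subspace of a unital C*-algebra. *)
Record opsys (R : realType) := OpSys {
  os_sort :> lmodType R[i] ;
  os_alg : cstarType R ;
  os_emb : {linear os_sort -> os_alg} ;
  os_emb_inj : injective os_emb ;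
  os_one : os_sort ;
  os_oneE : os_emb os_one = 1 ;
  os_star : os_sort -> os_sort ;
  os_starE : forall s, os_emb (os_star s) = star (os_emb s) }.

Section OperatorSystems.
Variables (R : realType) (S : opsys R).

(* The last clause is the positivity of the operator [phi(X_ij)] on H^k. *)
Definition ucp (H : hilbertType R) : set (S -> H -> H) :=
  [set phi | [/\ linear phi, forall s, bounded_op (phi s),
    phi (os_one S) = id &
    forall k (X : 'M[S]_k), mxpos (map_mx (os_emb S) X) ->
      forall xi : 'I_k -> H,
        0 <= \sum_i \sum_j ip (phi (X i j) (xi j)) (xi i)]].

Definition hamel_basis (B : set S) :=
  (forall (X : {fset S}) (c : S -> R[i]), [set` X] `<=` B ->
     \sum_(x <- X) c x *: x = 0 -> forall x, x \in X -> c x = 0) /\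
  (forall s : S, exists (X : {fset S}) (c : S -> R[i]),
     [set` X] `<=` B /\ s = \sum_(x <- X) c x *: x).

Definition is_cover (B : cstarType R) (theta : S -> B) :=
  [/\ linear theta, theta (os_one S) = 1,
      forall k (X : 'M[S]_k), cstar_mxnorm (map_mx theta X) =
                              cstar_mxnorm (map_mx (os_emb S) X)
    & cstar_generates (range theta)].

Definition is_max_cover (C : cstarType R) (j : S -> C) :=
  is_cover j /\
  forall (B : cstarType R) (theta : S -> B), is_cover theta ->
    exists pi : {lrmorphism C -> B},
      [/\ forall x, pi (star x) = star (pi x), set_surj setT setT pi &
          forall s, pi (j s) = theta s].

Definition dual : set {ptws S -> R[i]^o} :=
  [set f | linear (f : S -> R[i]^o) /\
     exists M : R[i], forall s, `|f s| <= M * `|os_emb S s|].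

Definition states : set {ptws S -> R[i]^o} :=
  [set f | [/\ linear (f : S -> R[i]^o), f (os_one S) = 1 &
     forall s, cpos (os_emb S s) -> 0 <= f s]].

(* L with the weak-* topology: the subset topology of pointwise convergence. *)
Definition state_space := set_type states.

Definition state_eval (s : S) : state_space -> R[i]^o :=
  fun phi => (set_val phi : {ptws S -> R[i]^o}) s.

(* Real affine weak-* continuous functions on the dual (values off the dual are
   irrelevant). *)
Definition affine_wstar (a : {ptws S -> R[i]^o} -> R) :=
  {within dual, continuous a} /\
  forall (f g : S -> R[i]^o) (t : R), dual f -> dual g -> 0 <= t <= 1 ->
    a (t%:C *: f + (1 - t)%:C *: g) = t * a f + (1 - t) * a g.

Definition CL : set (state_space -> R[i]^o) :=
  [set f | continuous f].

Definition real_CL : set (state_space -> R[i]^o) :=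
  [set f | CL f /\ forall phi, f phi \is Num.real].

(* [cone_closed] is closedness in C(L) for the uniform norm. *)
Record closed_max_cone (G : set (state_space -> R[i]^o)) : Prop := {
  cone_real : G `<=` real_CL ;
  coneD : forall f g, G f -> G g -> G (f + g) ;
  coneZ : forall (t : R) f, 0 <= t -> G f -> G (t%:C *: f) ;
  cone_max : forall f g, G f -> G g -> G (fun phi => Num.max (f phi) (g phi)) ;
  cone_closed : CL `&` closure (G : set {uniform state_space -> R[i]^o})
                  `<=` G }.

Definition Gamma : set (state_space -> R[i]^o) :=
  [set f | real_CL f /\
     forall (phi psi chi : state_space) (t : R), 0 <= t <= 1 ->
       set_val chi = t%:C *: (set_val phi : S -> R[i]^o)
                     + (1 - t)%:C *: (set_val psi : S -> R[i]^o) ->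
       f chi <= t%:C * f phi + (1 - t)%:C * f psi].

Record is_star_hom_CL (A : cstarType R) (q : A -> state_space -> R[i]^o) :
    Prop := {
  hom_CL : forall a, CL (q a) ;
  hom_linear : linear q ;
  hom_mul : monoid_morphism q ;
  hom_star : forall a phi, q (star a) phi = Num.conj (q a phi) }.

(* [nc_card] is the set of cardinals 1 <= n <= kappa, the cardinal n being
   represented by an index type [nc_idx n] of cardinality n.  [nc_sp n] is H_n,
   and [nc_amp m n], with the embeddings [nc_inj], is the direct sum of copies
   of H_n indexed by I_m, so that M_m(B(H_n)) is B(nc_amp m n) and the (i,j)
   entry of T is (inj i)^* T (inj j). *)
Record nc_frame := NcFrame {
  kappa : choiceType ;
  kappa_infinite : infinite_set [set: kappa] ;
  kappa_gt_dim : exists B : set S, [/\ hamel_basis B, (B #<= [set: kappa])%card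
                                    & ~~ ([set: kappa] #<= B)%card] ;
  nc_card : Type ;
  nc_idx : nc_card -> choiceType ;
  nc_idx_neq0 : forall n, [set: nc_idx n] !=set0 ;
  nc_idx_le : forall n, ([set: nc_idx n] #<= [set: kappa])%card ;
  nc_idx_inj : forall m n, ([set: nc_idx m] #= [set: nc_idx n])%card -> m = n ;
  nc_idx_surj : forall A : set kappa, A !=set0 ->
                exists n, ([set: nc_idx n] #= A)%card ;
  nc_sp : nc_card -> hilbertType R ;
  nc_sp_dim : forall n, exists e : nc_idx n -> nc_sp n, orthonormal_basis e ;
  nc_amp : nc_card -> nc_card -> hilbertType R ;
  nc_inj : forall m n, nc_idx m -> nc_sp n -> nc_amp m n ;
  nc_ampP : forall m n, hilbert_sum (@nc_inj m n) }.

Section NcFunctions.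
Variable W : nc_frame.
Local Notation H := (@nc_sp W).
Local Notation D := (@nc_amp W).
Local Notation inj := (@nc_inj W _ _).

Definition nc_K (n : nc_card W) : set (S -> H n -> H n) := @ucp (H n).

(* 1_m \otimes alpha *)
Definition nc_tensor (m n n' : nc_card W) (alpha : H n -> H n') : D m n -> D m n' :=
  xget (fun=> 0) [set T | bounded_op T /\
    forall i x, T (inj i x) = inj i (alpha x)].
Arguments nc_tensor m {n n'} alpha _.

(* Families F_n : K_n -> M_m(B(H_n)); only the values on K_n matter. *)
Definition nc_family (m : nc_card W) := forall n, (S -> H n -> H n) -> D m n -> D m n.

Record is_nc_fun m (F : nc_family m) : Prop := {
  nc_bounded : forall n x, nc_K x -> bounded_op (F n x) ;
  nc_direct_sum : forall n (J : choiceType) (nu : J -> nc_card W)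
      (x : forall i, S -> H (nu i) -> H (nu i))
      (alpha : forall i, H (nu i) -> H n) (y : S -> H n -> H n),
    (forall i, nc_K (x i)) -> (forall i, isometry_op (alpha i)) ->
    op_sum (fun i => alpha i \o adj (alpha i)) id ->
    nc_K y ->
    (forall s, op_sum (fun i => alpha i \o x i s \o adj (alpha i)) (y s)) ->
    op_sum (fun i => nc_tensor m (alpha i) \o F (nu i) (x i)
                       \o nc_tensor m (adj (alpha i))) (F n y) ;
  nc_unitary : forall n (x : S -> H n -> H n) (beta : H n -> H n),
    nc_K x -> unitary_op beta ->
    F n (fun s => beta \o x s \o adj beta) =
    nc_tensor m beta \o F n x \o nc_tensor m (adj beta) }.

Definition nc_selfadjoint m (F : nc_family m) :=
  forall n x, nc_K x -> adjoint_of (F n x) (F n x).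

Definition nc_convex m (F : nc_family m) :=
  forall n (x y : S -> H n -> H n) (t : R), nc_K x -> nc_K y -> 0 <= t <= 1 ->
    op_le (F n (t%:C *: x + (1 - t)%:C *: y))
          (t%:C *: F n x + (1 - t)%:C *: F n y).

Definition nc_entry m (F : nc_family m) (i j : nc_idx m)
    n (x : S -> H n -> H n) : H n -> H n :=
  adj (inj i) \o F n x \o inj j.

Definition nc_scalar_continuous
    (f : forall n, (S -> H n -> H n) -> H n -> H n) :=
  forall n x, nc_K x ->
    f n @ ptws_sstar_nbhs (@nc_K n) x `=>` sstar_nbhs (f n x).

Definition nc_continuous m (F : nc_family m) :=
  forall i j, nc_scalar_continuous (nc_entry F i j).

Section Xi.
Variables (C : cstarType R)
  (hat : forall n, (S -> H n -> H n) -> C -> H n -> H n).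

(* The *-isomorphism of C*_max(S) onto the continuous nc functions; [hat] is
   the extension of ucp maps to representations of C*_max(S). *)
Definition nc_Phi (b : C) : forall n, (S -> H n -> H n) -> H n -> H n :=
  fun n x => hat x b.

(* [g i j] is the preimage under Phi of the entry F^(i,j). *)
Definition Xi : set C :=
  [set b | exists m (F : nc_family m) (I : {fset nc_idx m})
      (c : nc_idx m -> R[i]) (g : nc_idx m -> nc_idx m -> C),
    [/\ is_nc_fun F, nc_selfadjoint F, nc_convex F, nc_continuous F &
      (forall i j n (x : S -> H n -> H n), i \in I -> j \in I -> nc_K x ->
         nc_Phi (g i j) x = nc_entry F i j x) /\
      b = \sum_(i <- I) \sum_(j <- I) (c j * Num.conj (c i)) *: g i j]].

End Xi.
End NcFunctions.
End OperatorSystems.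

(* Main.v *)
(* The one-dimensional maps s |-> phi(s) 1, for a state phi, are completely
   positive because a sum of elements y^* y of a C*-algebra is again of this form
   (Kelley-Vaught).  Their extensions to C*_max(S) are the characters
   b |-> q(b)(phi), so q(b) is the value at level 1 of the quadratic form of a
   convex nc function, hence convex.  Conversely, a self-adjoint s in S gives the
   affine nc function x |-> x(s), so q(Xi) contains all functions
   phi |-> Re phi(s) + c, and a weak-* continuous real affine function on S^* is of
   this form.  Finally, a continuous convex F on the compact set L has, for
   every point phi0 and e > 0, a strict minorant Re phi(s) + c equal to F - e at
   phi0; by compactness, maxima of finitely many of these approximate F
   uniformly. *)
Require Import Defs.
From mathcomp Require Import all_boot all_order all_algebra finmap complex.
From mathcomp Require Import all_classical all_reals all_analysis.
From mathcomp Require Import ring lra.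
From mathcomp Require Import sesquilinear.
Import Order.TTheory GRing.Theory Num.Theory numFieldNormedType.Exports.
Set Implicit Arguments.
Unset Strict Implicit.
Unset Printing Implicit Defensive.
Local Open Scope classical_set_scope.
Local Open Scope complex_scope.
Local Open Scope ring_scope.

(** * Real-valued norms *)

(** Squares [star y * y] are not visibly closed under addition, which is what complete positivity of
    states requires. They are therefore compared with the norm condition $|M - a| \le M$ on
    self-adjoint $a$, which is stable under sums by the triangle inequality; the equivalence of the
    two rests on the $C^*$-identity, completeness and an iteration for square roots. The maps [q]
    and [hat] are tied together only by their values on the range of [j]. Their agreement at the
    one-dimensional level uses that this range generates and that characters are automatically
    contractive. A separating functional for a convex function has to be an evaluation at an element
    of [S]. This is why the minorant is obtained by minimizing a function of finitely many
    evaluations and of [F]: the gradient at the minimum is then a finite combination of these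
    evaluations. *)

Section RealNorm.
Variables (R : realType) (V : normedModType R[i]).
Implicit Types x y : V.

(** Norms are [R[i]]-valued; their real parts lie in an ordered field, where estimates can be
    combined by real arithmetic. *)
Definition rnorm x : R := complex.Re `|x|.

Lemma rnormE x : `|x| = (rnorm x)%:C.
Proof. by rewrite /rnorm RRe_real // ger0_real. Qed.

Lemma rnorm_ge0 x : 0 <= rnorm x.
Proof. by rewrite -ler0c -rnormE. Qed.

Lemma rnorm0 : rnorm 0 = 0.
Proof. by rewrite /rnorm normr0. Qed.

Lemma rnorm_eq0 x : rnorm x = 0 -> x = 0.
Proof. by move=> h; apply: normr0_eq0; rewrite rnormE h. Qed.

Lemma rnormN x : rnorm (- x) = rnorm x.
Proof. by rewrite /rnorm normrN. Qed.

Lemma rnormB x y : rnorm (x - y) = rnorm (y - x).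
Proof. by rewrite /rnorm distrC. Qed.

Lemma rnormD x y : rnorm (x + y) <= rnorm x + rnorm y.
Proof. by rewrite -lecR rmorphD /= -!rnormE ler_normD. Qed.

Lemma rnormBD x y z : rnorm (x - z) <= rnorm (x - y) + rnorm (y - z).
Proof. by apply: le_trans (rnormD _ _); rewrite addrA subrK. Qed.

Lemma rnormZ (a : R[i]) x : rnorm (a *: x) = complex.Re `|a| * rnorm x.
Proof.
by rewrite {1}/rnorm normrZ rnormE -(@RRe_real _ `|a|) ?ger0_real // -rmorphM.
Qed.

Lemma rnormZr (a : R) x : 0 <= a -> rnorm (a%:C *: x) = a * rnorm x.
Proof. by move=> a0; rewrite rnormZ ger0_norm ?ler0c. Qed.

(** Passages to the limit are put in this form: an estimate with error [c * e], where [c] does not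
    depend on [e]. *)
Lemma le0_linear_bound (c t : R) : (forall e : R,
  0 < e -> t <= c * e) -> t <= 0.
Proof.
move=> h; rewrite leNgt; apply/negP => t0.
have c0 : 0 < c by have := h 1 ltr01; lra.
have := h (t / (c + c)); rewrite divr_gt0 ?addr_gt0 // => /(_ isT).
suff -> : c * (t / (c + c)) = t / 2 by lra.
by field; rewrite lt0r_neq0 // addr_gt0.
Qed.

Lemma rnorm_eq_small (c : R) (x y : V) :
  (forall e : R, 0 < e -> rnorm (x - y) <= c * e) -> x = y.
Proof.
move=> h; apply/eqP; rewrite -subr_eq0; apply/eqP/rnorm_eq0/le_anti.
by rewrite rnorm_ge0 andbT; apply: le0_linear_bound h.
Qed.

End RealNorm.

Section Complete.
Variables (R : realType) (V : completeNormedModType R[i]).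

(** Serves two sequences: the square root iteration, and the minimizing sequence of an orthogonal
    projection. *)
Lemma rnorm_complete (u : nat -> V) :
  (forall e : R, 0 < e -> exists N, forall m n, (N <= m)%N -> (N <= n)%N ->
     rnorm (u m - u n) <= e) ->
  exists l, forall e : R, 0 < e -> exists N, forall n, (N <= n)%N ->
    rnorm (u n - l) <= e.
Proof.
move=> uC.
have /cauchy_cvg/cvg_ex [l ul] : cauchy (u @ \oo).
  apply/cauchy_ballP => e e0.
  have e1 : 0 < complex.Re e by rewrite -ltcR RRe_real // gtr0_real.
  have e2 : 0 < complex.Re e / 2 by rewrite divr_gt0.
  have [N hN] := uC _ e2.
  exists ([set u n | n in [set n | (N <= n)%N]],
    [set u n | n in [set n | (N <= n)%N]]).
    by split=> /=; exists N => // n /= Nn; exists n.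
  move=> [x y] /= [[m Nm <-] [n Nn <-]].
  rewrite -ball_normE /= rnormE -(@RRe_real _ e) ?gtr0_real // ltcR.
  apply: le_lt_trans (hN _ _ Nm Nn) _.
  by rewrite ltr_pdivrMr // ltr_pMr // ltr1n.
exists l => e e0.
have /cvgrPdist_le /(_ e%:C) := ul.
rewrite (ltcR 0 e) => /(_ e0) [N _ hN]; exists N => n Nn.
by have := hN n Nn; rewrite /= rnormE rnormB lecR.
Qed.

End Complete.

(** * Norm, involution and the square root iteration in a $C^*$-algebra *)

Section CStarFacts.
Variables (R : realType) (A : cstarType R).
Implicit Types x y z a b h k : A.

Lemma rnormM x y : rnorm (x * y) <= rnorm x * rnorm y.
Proof. by rewrite -lecR rmorphM /= -!rnormE; exact: cs_normM. Qed.

Lemma rnorm_starM x : rnorm (star x * x) = rnorm x ^+ 2.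
Proof.
have := cs_norm_star x; rewrite !rnormE -rmorphXn /= => /complexI.
by [].
Qed.

Lemma starM x y : star (x * y) = star y * star x. Proof. exact: cs_starM. Qed.

Lemma star1 : star (1 : A) = 1.
Proof. by have := starM (star 1) 1; rewrite mulr1 starK mulr1. Qed.

Lemma star0 : star (0 : A) = 0.
Proof. by rewrite -(scale0r 0) starZ rmorph0 !scale0r. Qed.

Lemma starN x : star (- x) = - star x.
Proof. by rewrite -scaleN1r starZ rmorphN1 scaleN1r. Qed.

Lemma starB x y : star (x - y) = star x - star y.
Proof. by rewrite starD starN. Qed.

Lemma starZr (t : R) x : star (t%:C *: x) = t%:C *: star x.
Proof. by rewrite starZ conj_Creal // complex_real. Qed.

Lemma star_sum (I : Type) (r : seq I) (P : pred I) (F : I -> A) :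
  star (\sum_(i <- r | P i) F i) = \sum_(i <- r | P i) star (F i).
Proof. exact: (big_morph _ (@starD R A) star0). Qed.

(** The $C^*$-identity bounds $|y|^2$ by the product of the norms of [star y] and [y]. Dividing
    gives one inequality, and [star y] in place of [y] gives the other. *)
Lemma rnorm_star x : rnorm (star x) = rnorm x.
Proof.
suff le y : rnorm y <= rnorm (star y).
  by apply/le_anti; rewrite le andbT; have := le (star x); rewrite starK.
have [/eqP y0|y0] := eqVneq (rnorm y) 0.
  by move/eqP: y0 => ->; rewrite rnorm_ge0.
have y1 : 0 < rnorm y by rewrite lt_def y0 rnorm_ge0.
by rewrite -(ler_pM2r y1) -expr2 -rnorm_starM rnormM.
Qed.

Lemma rnorm1 : rnorm (1 : A) = 1.
Proof.
have := rnorm_starM 1; rewrite star1 mulr1 expr2 => h.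
apply: (@mulfI _ (rnorm (1 : A))); last by rewrite mulr1.
apply/eqP => /rnorm_eq0 /eqP; apply/negP.
exact: oner_neq0.
Qed.

(* The solution of y = (x + y^2)/2, i.e. y = 1 - sqrt(1 - x); the iteration is
   dominated by the same iteration for x = 1 in the reals. *)
Lemma sqrt_fixpoint x : star x = x -> rnorm x <= 1 ->
  exists y, [/\ star y = y, rnorm y <= 1, y + y = x + y * y &
    forall z, z * x = x * z -> z * y = y * z].
Proof.
move=> xs x1.
pose u n : A := iter n (fun y => (2^-1)%:C *: (x + y * y)) 0.
pose r n : R := iter n (fun s => 2^-1 * (1 + s * s)) 0.
have uS n : u n.+1 = (2^-1)%:C *: (x + u n * u n) by [].
have rS n : r n.+1 = 2^-1 * (1 + r n * r n) by [].
have r01 n : 0 <= r n <= 1.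
  elim: n => [|n /andP[r0 r1]]; first by rewrite /= lexx ler01.
  rewrite rS; nra.
have ur n : rnorm (u n) <= r n.
  elim: n => [|n IH]; first by rewrite rnorm0.
  rewrite uS rS rnormZr ?invr_ge0 // ler_wpM2l ?invr_ge0 //.
  apply: le_trans (rnormD _ _) _; apply: lerD => //.
  apply: le_trans (rnormM _ _) _.
  by apply: ler_pM; rewrite ?rnorm_ge0.
have uSr n : rnorm (u n.+1 - u n) <= r n.+1 - r n.
  elim: n => [|n IH].
    rewrite uS rS !mulr0 !addr0 !subr0 rnormZr ?invr_ge0 //.
    by rewrite ler_wpM2l ?invr_ge0.
  rewrite (uS n.+1) {2}(uS n) -scalerBr rnormZr ?invr_ge0 //.
  (* This splitting of a difference of squares is valid without commutativity. *)
  have -> : x + u n.+1 * u n.+1 - (x + u n * u n) =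
            u n.+1 * (u n.+1 - u n) + (u n.+1 - u n) * u n.
    by rewrite mulrBr mulrBl opprD addrACA subrr add0r addrA subrK.
  have b : rnorm (u n.+1 * (u n.+1 - u n) + (u n.+1 - u n) * u n) <=
           (r n.+1 + r n) * (r n.+1 - r n).
    apply: le_trans (rnormD _ _) _; rewrite [leRHS]mulrDl; apply: lerD.
      by apply: le_trans (rnormM _ _) _; apply: ler_pM; rewrite ?rnorm_ge0.
    apply: le_trans (rnormM _ _) _; rewrite mulrC.
    by apply: ler_pM; rewrite ?rnorm_ge0.
  move: (rS n.+1) (rS n) b; set r2 := r n.+2; set r1 := r n.+1; lra.
have umn m n : (n <= m)%N -> rnorm (u m - u n) <= r m - r n.
  elim: m => [|m IH]; first by rewrite leqn0 => /eqP ->; rewrite !subrr rnorm0.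
  rewrite leq_eqVlt => /predU1P[->|]; first by rewrite !subrr rnorm0.
  rewrite ltnS => /IH nm; apply: le_trans (rnormBD _ (u m) _) _.
  by have := uSr m; lra.
have rC (e : R) : 0 < e -> exists N, forall m, (N <= m)%N -> r m - r N <= e.
  move=> e0; have hs : has_sup (range r).
    split; first by exists (r 0%N), 0%N.
    by exists 1 => _ [n _ <-]; case/andP: (r01 n).
  have [_ [N _ <-] hN] := sup_adherent e0 hs.
  exists N => m _; have := ub_le_sup hs.2 (ex_intro2 _ _ m I erefl : range r
    (r m)).
  lra.
have [y yl] : exists y, forall e : R, 0 < e -> exists N, forall n, (N <= n)%N ->
    rnorm (u n - y) <= e.
  apply: rnorm_complete => e e0.
  have e2 : 0 < e / 2 by rewrite divr_gt0.
  have [N hN] := rC _ e2.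
  exists N => m n Nm Nn; apply: le_trans (rnormBD _ (u N) _) _.
  rewrite (rnormB (u N)); have := umn _ _ Nm; have := umn _ _ Nn.
  have := hN _ Nm; have := hN _ Nn; set d := e / _.
  have -> : e = d + d by rewrite /d; field.
  lra.
have us n : star (u n) = u n.
  by elim: n => [|n IH]; rewrite ?star0 // uS starZr starD starM IH xs.
have y1 : rnorm y <= 1.
  suff : rnorm y - 1 <= 0 by lra.
  apply: (@le0_linear_bound _ 1) => e e0; rewrite mul1r.
  have [N /(_ N (leqnn N)) hN] := yl _ e0.
  have := rnormBD y (u N) 0; rewrite !subr0 (rnormB y).
  by have := ur N; case/andP: (r01 N); lra.
exists y; split => //.
- apply: (@rnorm_eq_small _ _ 2) => e e0.
  have [N /(_ N (leqnn N)) hN] := yl _ e0.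
  apply: le_trans (rnormBD _ (u N) _) _.
  have : rnorm (star y - u N) = rnorm (u N - y).
    by rewrite -(us N) -starB rnorm_star rnormB us.
  lra.
- apply: (@rnorm_eq_small _ _ 4) => e e0.
  have [N hN] := yl _ e0.
  have h1 := hN N (leqnn N); have h2 := hN N.+1 (leqnSn N).
  (* The recursion $2 u_{N+1} = x + u_N^2$ is exact, so the defect of the limit is a sum of four
     errors of norm at most [e]. *)
  have -> : y + y - (x + y * y) = (y - u N.+1) + (y - u N.+1) +
      (u N * (u N - y) + (u N - y) * y).
    have -> : u N * (u N - y) + (u N - y) * y = (x + u N * u N) - (x + y * y).
      by rewrite mulrBr mulrBl addrA subrK opprD addrACA subrr add0r.
    have -> : x + u N * u N = u N.+1 + u N.+1.
      rewrite uS -scalerDl -rmorphD /= (_ : 2^-1 + 2^-1 = 1) ?scale1r //; lra.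
    by rewrite (addrACA y) -opprD addrA subrK.
  have b1 : rnorm (u N * (u N - y)) <= e.
    apply: le_trans (rnormM _ _) _; rewrite -[e]mul1r.
    apply: ler_pM; rewrite ?rnorm_ge0 //.
    by have := ur N; case/andP: (r01 N); lra.
  have b2 : rnorm ((u N - y) * y) <= e.
    apply: le_trans (rnormM _ _) _; rewrite -[e]mulr1.
    by apply: ler_pM; rewrite ?rnorm_ge0 //.
  apply: le_trans (rnormD _ _) _.
  have := rnormD (y - u N.+1) (y - u N.+1); rewrite (rnormB y).
  have := rnormD (u N * (u N - y)) ((u N - y) * y).
  lra.
- move=> z zx.
  have zu n : z * u n = u n * z.
    elim: n => [|n IH]; first by rewrite mulr0 mul0r.
    rewrite uS -scalerAr -scalerAl mulrDr mulrDl zx; congr (_ *: (_ + _)).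
    by rewrite mulrA IH -mulrA IH mulrA.
  apply: (@rnorm_eq_small _ _ (2 * rnorm z)) => e e0.
  have [N /(_ N (leqnn N)) hN] := yl _ e0.
  have -> : z * y - y * z = (u N - y) * z - z * (u N - y).
    by rewrite mulrBl mulrBr zu opprB [RHS]addrC addrA subrK.
  apply: le_trans (rnormD _ _) _; rewrite rnormN.
  have := rnormM z (u N - y); have := rnormM (u N - y) z.
  have := rnorm_ge0 z; nra.
Qed.

End CStarFacts.

(** * Positive elements of C*-algebras *)

Section CStarPositive.
Variables (R : realType) (A : cstarType R).
Implicit Types x y z a b h k : A.

(* For self-adjoint a this says that the spectrum of a is nonnegative. *)
Definition ppos a := star a = a /\
  exists2 M : R, 0 <= M & rnorm (M%:C *: 1 - a) <= M.

(** The bounds [M] and [N] add up; this additivity is the reason for working with [ppos] instead of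
    squares. *)
Lemma pposD a b : ppos a -> ppos b -> ppos (a + b).
Proof.
move=> [sa [M M0 aM]] [sb [N N0 bN]]; split; first by rewrite starD sa sb.
exists (M + N); first exact: addr_ge0.
rewrite rmorphD /= scalerDl opprD addrACA.
by apply: le_trans (rnormD _ _) _; apply: lerD.
Qed.

Lemma pposZ (t : R) a : 0 <= t -> ppos a -> ppos (t%:C *: a).
Proof.
move=> t0 [sa [M M0 aM]]; split; first by rewrite starZr sa.
exists (t * M); first exact: mulr_ge0.
rewrite rmorphM /= -scalerA -scalerBr rnormZr //.
by rewrite ler_wpM2l.
Qed.

Lemma ppos0 : ppos 0.
Proof. by split; [exact: star0 | exists 0;
  rewrite ?scale0r ?subrr ?rnorm0]. Qed.

Lemma ppos_sum (I : Type) (r : seq I) (F : I -> A) :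
  (forall i, ppos (F i)) -> ppos (\sum_(i <- r) F i).
Proof.
move=> hF; elim: r => [|i r IH]; first by rewrite big_nil; exact: ppos0.
by rewrite big_cons; apply: pposD.
Qed.

Lemma sqr_1B y : (1 - y) * (1 - y) = 1 - (y + y - y * y).
Proof. by rewrite mulrBl mul1r mulrBr mulr1 -addrA -opprD addrA. Qed.

Lemma scale_half x : (2^-1)%:C *: (x + x) = x.
Proof.
by rewrite scalerDr -scalerDl -rmorphD /= (_ : 2^-1 + 2^-1 = 1) ?scale1r //;
  lra.
Qed.

(** For $x = 1 - a/M$, of norm at most 1, the fixed point $y = 1 - \sqrt{1-x}$ yields the root
    $\sqrt{M}(1-y)$ of $a$; if $M = 0$ then $a = 0$. The last clause supplies the commutation
    relations between roots that are used later. *)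
Lemma ppos_sqrt a : ppos a -> exists k, [/\ star k = k, ppos k, k * k = a &
  forall z, z * a = a * z -> z * k = k * z].
Proof.
move=> [sa [M]]; rewrite le_eqVlt => /predU1P[<-|M0] aM.
  exists 0; split; [exact: star0 | exact: ppos0 | | by move=> z;
    rewrite mulr0 mul0r].
  rewrite scale0r sub0r rnormN in aM; rewrite mulr0;
    apply/esym/rnorm_eq0/le_anti.
  by rewrite aM rnorm_ge0.
have Mn : M != 0 by rewrite gt_eqF.
pose x := 1 - M^-1%:C *: a.
have xs : star x = x by rewrite starB star1 starZr sa.
have xE : x = M^-1%:C *: (M%:C *: 1 - a).
  by rewrite scalerBr scalerA -rmorphM /= mulVf // scale1r.
have x1 : rnorm x <= 1.
  by rewrite xE rnormZr ?invr_ge0 ?(ltW M0) // ler_pdivrMl // mulr1.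
have [y [ys y1 yE yC]] := sqrt_fixpoint xs x1.
have sM : (Num.sqrt M)%:C * (Num.sqrt M)%:C = M%:C :> R[i].
  by rewrite -rmorphM /= -expr2 sqr_sqrtr // ltW.
exists ((Num.sqrt M)%:C *: (1 - y)); split.
- by rewrite starZr starB star1 ys.
- split; first by rewrite starZr starB star1 ys.
  exists (Num.sqrt M); first exact: sqrtr_ge0.
  rewrite -scalerBr subKr rnormZr ?sqrtr_ge0 //.
  by rewrite -[leRHS]mulr1 ler_wpM2l ?sqrtr_ge0.
- rewrite -scalerAl -scalerAr scalerA sM.
  by rewrite sqr_1B yE addrK subKr scalerA -rmorphM /= mulfV // scale1r.
- move=> z za; rewrite -scalerAl -scalerAr mulrBl mulrBr mul1r mulr1 yC //.
  by rewrite mulrBl mulrBr mul1r mulr1 -scalerAl -scalerAr za.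
Qed.

(* u = h + i k satisfies u^* u = c and 2 i k = u - u^*. *)
Lemma rnorm_commuting_sq h k (c : R) : 0 <= c -> star h = h -> star k = k ->
  h * k = k * h -> h * h + k * k = c%:C *: 1 -> rnorm k ^+ 2 <= c.
Proof.
move=> c0 hs ks hk hkc; pose u := h + 'i *: k.
have us : star u = h - 'i *: k.
  by rewrite starD starZ hs ks conjCi scaleNr.
have uu : star u * u = c%:C *: 1.
  have ii : ('i *: k) * ('i *: k) = - (k * k).
    by rewrite -scalerAl -scalerAr scalerA -expr2 sqrCi scaleN1r.
  by rewrite us mulrDr !mulrBl ii opprK -scalerAl -scalerAr hk addrA subrK.
have u2 : rnorm u ^+ 2 = rnorm (c%:C *: 1 : A) by rewrite -rnorm_starM uu.
have nk : 2 * rnorm k <= 2 * rnorm u.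
  have -> : 2 * rnorm k = rnorm (u - star u).
    rewrite us /u opprB addrC addrA subrK -scalerDl rnormZ.
    by rewrite -mulr2n normrMn normCi.
  by apply: le_trans (rnormD _ _) _; rewrite rnormN rnorm_star; lra.
have k0 := rnorm_ge0 k.
rewrite rnormZr // rnorm1 mulr1 in u2.
rewrite -u2; apply: lerXn2r; rewrite ?nnegrE ?rnorm_ge0 //; lra.
Qed.

(** Scale to norm at most 1. The root $k$ of $1 - h^2$ commutes with $h$ and $h^2 + k^2 = 1$, so
    $|k| \le 1$ and $|1 - h^2| = |k^2| \le 1$: the bound $M = 1$ works. *)
Lemma ppos_sq h : star h = h -> ppos (h * h).
Proof.
suff H g : star g = g -> rnorm g <= 1 -> ppos (g * g).
  (* Adding 1 keeps the scaling factor invertible when [h] is zero. *)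
  move=> hs; pose t := rnorm h + 1.
  have t0 : 0 < t by rewrite ltr_wpDl ?rnorm_ge0.
  have tn : t != 0 by rewrite gt_eqF.
  have -> : h * h = (t * t)%:C *: ((t^-1%:C *: h) * (t^-1%:C *: h)).
    rewrite -scalerAl -scalerAr !scalerA -!rmorphM /= (_ : t * t / t / t = 1)
      ?scale1r //.
    by field.
  apply: pposZ; first by rewrite mulr_ge0 ?ltW.
  apply: H; first by rewrite starZr hs.
  rewrite rnormZr ?invr_ge0 ?(ltW t0) // ler_pdivrMl // mulr1 /t; lra.
move=> gs g1.
have xs : star (g * g) = g * g by rewrite starM gs.
have x1 : rnorm (g * g) <= 1.
  by apply: le_trans (rnormM _ _) _; rewrite mulr_ile1 ?rnorm_ge0.
have [y [ys y1 yE yC]] := sqrt_fixpoint xs x1.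
pose k := 1 - y.
have ks : star k = k by rewrite starB star1 ys.
have kk : k * k = 1 - g * g.
  by rewrite sqr_1B yE addrK.
have gk : g * k = k * g.
  by rewrite mulrBl mulrBr mul1r mulr1 yC // mulrA.
have k1 : rnorm k ^+ 2 <= 1.
  by apply: (rnorm_commuting_sq ler01 gs ks gk); rewrite kk addrC subrK scale1r.
split => //; exists 1 => //.
rewrite scale1r -kk; apply: le_trans (rnormM _ _) _; by rewrite -expr2.
Qed.

(** Roots $k$ of $a$ and $l$ of $-a$ commute and satisfy $k^2 + l^2 = 0$, so [rnorm_commuting_sq]
    with $c = 0$ gives $k = 0$. *)
Lemma ppos_anti a : ppos a -> ppos (- a) -> a = 0.
Proof.
move=> /ppos_sqrt[k [ks _ kk kC]] /ppos_sqrt[l [ls _ ll lC]].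
have lk : l * k = k * l.
  by apply: kC; apply: oppr_inj; rewrite -mulrN -mulNr -ll mulrA.
have : rnorm k ^+ 2 <= 0.
  by apply: (rnorm_commuting_sq (lexx 0) ls ks lk); rewrite kk ll addNr scale0r.
move=> k2; have /eqP : rnorm k ^+ 2 = 0 by apply/le_anti; rewrite k2 sqr_ge0.
by rewrite sqrf_eq0 => /eqP/rnorm_eq0 k0; rewrite -kk k0 mulr0.
Qed.

Lemma bernoulli (d : R) n : 0 <= d -> 1 + n%:R * d <= (1 + d) ^+ n.
Proof.
move=> d0; elim: n => [|n IH]; first by rewrite expr0 mul0r addr0.
have n0 : 0 <= n%:R * d * d by rewrite !mulr_ge0.
rewrite exprS -natr1; apply: le_trans (ler_wpM2l _ IH); nra.
Qed.

(** Exponential growth beats linear growth. Only exponents $2^m$ occur, because the $C^*$-identity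
    gives $|x^n| = |x|^n$ for self-adjoint $x$ by repeated squaring. *)
Lemma dyadic_pow_linear_bound (s K : R) :
  (forall m, s ^+ (2 ^ m) <= 1 + (2 ^ m)%:R * K) -> s <= 1.
Proof.
move=> H; rewrite leNgt; apply/negP => s1.
pose d := s - 1; have d0 : 0 < d by rewrite subr_gt0.
have K0 : 0 <= K.
  by have := H 0%N; rewrite expn0 expr1 mul1r /=; rewrite /d in d0; lra.
(* Bernoulli is linear in the exponent, so it is squared: at exponent $2^{N+1}$ the lower bound
   contains $(2^N d)^2$, and [N] makes this larger than $2^{N+1} K$. *)
pose N := Num.bound (2 * K / d ^+ 2).
have hN : 2 * K / d ^+ 2 < N%:R.
  have h0 : 0 <= 2 * K / d ^+ 2 by rewrite divr_ge0 ?sqr_ge0 // mulr_ge0.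
  exact: archi_boundP.
have hN2 : 2 * K < (2 ^ N)%:R * d ^+ 2.
  rewrite -ltr_pdivrMr ?exprn_gt0 //; apply: lt_le_trans hN _.
  by rewrite ler_nat ltnW // ltn_expl.
have := H N.+1; rewrite expnS mulnC exprM natrM.
have b : 1 + (2 ^ N)%:R * d <= s ^+ (2 ^ N).
  have e : 1 + d = s by rewrite /d addrC subrK.
  by rewrite -[s in leRHS]e; exact: bernoulli (ltW d0).
have n0 : 0 <= (2 ^ N)%:R * d by rewrite mulr_ge0 // ltW.
have b2 : (1 + (2 ^ N)%:R * d) ^+ 2 <= (s ^+ (2 ^ N)) ^+ 2.
  by apply: lerXn2r; rewrite ?nnegrE //; lra.
have n1 : 1 <= (2 ^ N)%:R :> R by rewrite ler1n expn_gt0.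
move: b2 hN2 n0 n1; set n := (2 ^ N)%:R; set S := (s ^+ _) ^+ 2.
nra.
Qed.

Lemma rnorm_pow2 x m : star x = x -> rnorm (x ^+ (2 ^ m)) = rnorm x ^+ (2 ^ m).
Proof.
move=> xs; elim: m => [|m IH]; first by rewrite !expr1.
have xn n : star (x ^+ n) = x ^+ n.
  by elim: n => [|n IHn];
    rewrite ?expr0 ?star1 // {1}exprSr starM IHn xs -exprS.
by rewrite expnS mulnC !exprM -IH -rnorm_starM xn expr2.
Qed.

(* The powers of w = M + t t^* are w^n = M^n + t g_n t^*, where g_n is a
   polynomial in v = M + t^* t of norm at most n M^(n-1); since
   |w|^n = |w^n| for n = 2^m, this gives |w| <= M. *)
Lemma ppos_opp_swap t : ppos (- (star t * t)) -> ppos (- (t * star t)).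
Proof.
move=> [_ [M M0]]; rewrite opprK => p.
split; first by rewrite starN starM starK.
exists M => //; rewrite opprK.
set v := (_ + star t * t) in p *. 
pose w := M%:C *: 1 + t * star t.
(* The power estimate divides by [M]; for [M = 0] the hypothesis already says $|t|^2 \le 0$. *)
move: M0; rewrite le_eqVlt => /predU1P[M0|M0].
  move: p; rewrite /v -M0 !scale0r !add0r rnorm_starM => h.
  apply: le_trans (rnormM _ _) _.
  by rewrite rnorm_star -expr2.
pose K := rnorm t * rnorm t.
have K0 : 0 <= K by rewrite mulr_ge0 ?rnorm_ge0.
have pw n : exists2 g, w ^+ n = (M ^+ n)%:C *: 1 + t * g * star t &
    M * rnorm g <= n%:R * M ^+ n.
  elim: n => [|n [g wg gn]].
    by exists 0; rewrite ?rnorm0 ?mulr0 ?mul0r ?expr0 ?scale1r ?addr0.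
  (* The relation $w t = t v$ moves the new factor $w$ past $t$, where it becomes $v$; the summand
     $M^n$ comes from the $t t^*$ part of $w$ multiplied by $M^n$. *)
  exists (v * g + (M ^+ n)%:C *: 1).
    rewrite exprS wg /w /v mulrDr !mulrDl -!scalerAl !mul1r scalerA -rmorphM
      /= -exprS.
    rewrite -!scalerAr !mulr1 !mulrDr !mulrDl -addrA; congr (_ + _).
    rewrite -!scalerAr -!scalerAl !mulr1 !mulrA.
    by rewrite addrC.
  rewrite -natr1 [leRHS]mulrDl mul1r.
  have h1 := rnormD (v * g) ((M ^+ n)%:C *: 1).
  rewrite rnormZr ?exprn_ge0 ?(ltW M0) // rnorm1 mulr1 in h1.
  have h2 : rnorm (v * g) <= M * rnorm g.
    by apply: le_trans (rnormM _ _) _; rewrite ler_wpM2r ?rnorm_ge0.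
  rewrite exprS; have := ltW M0; nra.
have ws : star w = w by rewrite starD starZr star1 starM starK.
have sM : rnorm w / M <= 1.
  apply: (@dyadic_pow_linear_bound _ (K / M)) => m.
  have [g wg gn] := pw (2 ^ m)%N; set n := (2 ^ m)%N in wg gn *.
  have : rnorm (w ^+ n) <= M ^+ n + K * rnorm g.
    rewrite wg; apply: le_trans (rnormD _ _) _; apply: lerD.
      by rewrite rnormZr ?exprn_ge0 ?(ltW M0) // rnorm1 mulr1.
    apply: le_trans (rnormM _ _) _; rewrite rnorm_star.
    have := rnormM t g; have := rnorm_ge0 t; rewrite /K; nra.
  rewrite rnorm_pow2 // expr_div_n ler_pdivrMr ?exprn_gt0 // => h.
  apply: le_trans h _; rewrite mulrDl mul1r lerD2l.
  rewrite -(ler_pM2r M0).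
  have -> : n%:R * (K / M) * M ^+ n * M = K * (n%:R * M ^+ n).
    by field; rewrite gt_eqF.
  by rewrite -mulrA ler_wpM2l // mulrC.
by move: sM; rewrite ler_pdivrMr // mul1r.
Qed.

(** Let $a = y^* y$, let $c$ be the root of $a^2$, and let $b = c - a$, twice the negative part of
    $a$. From $b^2 = 2cb$ one gets $t^* t = -c b^2 = -(lb)^2$ for $t = yb$ and $l$ the root of $c$.
    So $-t^* t$ is positive, hence also $-t t^*$ by [ppos_opp_swap]. But $t^* t + t t^*$ is half a
    sum of two self-adjoint squares, so $t^* t$ is positive as well and vanishes. Then $lb = 0$,
    hence $b^2 = 0$, $b = 0$ and $a = c$. *)
Lemma ppos_star_mul y : ppos (star y * y).
Proof.
pose a := star y * y.
have sa : star a = a by rewrite starM starK.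
have [c [cs cp cc cC]] := ppos_sqrt (ppos_sq sa).
have [l [ls lp ll lC]] := ppos_sqrt cp.
have ac : a * c = c * a by apply: cC; rewrite mulrA.
pose b := c - a.
have bs : star b = b by rewrite starB cs sa.
have bc : b * c = c * b by rewrite mulrBl mulrBr ac.
have bl : b * l = l * b by apply: lC.
have ba : b * a = a * b by rewrite mulrBl mulrBr ac.
have bb : b * b = c * b + c * b.
  rewrite {1}/b mulrBl; congr (_ + _).
  by rewrite /b !mulrBr opprB cc ac.
pose t := y * b.
have tt : - (star t * t) = (l * b) * (l * b).
  have -> : (l * b) * (l * b) = c * (b * b).
    by rewrite -mulrA (mulrA b) bl !mulrA ll.
  have -> : star t * t = a * (b * b).
    by rewrite starM bs !mulrA -(mulrA b) -/a ba.
  have -> : a = c - b by rewrite subKr.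
  have bbb : b * (b * b) = c * (b * b) + c * (b * b).
    by rewrite {1}bb mulrDr !mulrA bc.
  by rewrite mulrBl bbb opprB addrK.
have tpos : ppos (- (star t * t)).
  by rewrite tt; apply: ppos_sq; rewrite starM bs ls.
have spos : ppos (star t * t + t * star t).
  pose p := t + star t; pose m := 'i *: (t - star t).
  have ps : star p = p by rewrite starD starK addrC.
  have ms : star m = m
    by rewrite starZ starB starK conjCi scaleNr -scalerN opprB.
  have -> : star t * t + t * star t = (2^-1)%:C *: (p * p + m * m).
    have -> : m * m = - ((t - star t) * (t - star t)).
      by rewrite -scalerAl -scalerAr scalerA -expr2 sqrCi scaleN1r.
    have -> : p * p - (t - star t) * (t - star t) =
        (star t * t + t * star t) + (star t * t + t * star t).
      rewrite mulrDl [X in _ - X]mulrBl opprB [star t * (_ - _) - _]addrC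
        addrACA.
      rewrite -mulrBr -mulrDr {1}/p opprB [_ + (star t - t)]addrC addrA subrK.
      rewrite /p addrA addrAC addrK !mulrDr addrACA.
      by rewrite (addrC (star t * t)).
    by rewrite scale_half.
  by apply: pposZ; rewrite ?invr_ge0 //; apply: pposD; apply: ppos_sq.
have t0 : star t * t = 0.
  apply: ppos_anti => //; rewrite -[star t * t](addrK (t * star t)).
  by apply: pposD => //; apply: ppos_opp_swap.
have lb0 : l * b = 0.
  apply: rnorm_eq0; apply/eqP;
    rewrite -sqrf_eq0 -rnorm_starM starM bs ls bl -tt.
  by rewrite t0 oppr0 rnorm0.
have b0 : b = 0.
  apply: rnorm_eq0; apply/eqP;
    rewrite -sqrf_eq0 -rnorm_starM bs bb -ll -!mulrA lb0.
  by rewrite mulr0 addr0 rnorm0.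
by rewrite -/a -[a](subKr c) -/b b0 subr0.
Qed.

Lemma ppos_cpos a : ppos a -> cpos a.
Proof. by move=> /ppos_sqrt[k [ks _ <- _]]; exists k; rewrite ks. Qed.

Lemma cpos_sum_star_mul (I : Type) (r : seq I) (F : I -> A) :
  cpos (\sum_(i <- r) star (F i) * F i).
Proof. by apply/ppos_cpos/ppos_sum => i; exact: ppos_star_mul. Qed.

(** The bound $M = |a|$ works in [ppos]. The shift turns statements about positive elements into
    statements about self-adjoint ones. *)
Lemma cpos_rnormD a : star a = a -> cpos ((rnorm a)%:C *: 1 + a).
Proof.
move=> sa; apply: ppos_cpos; split; first by rewrite starD starZr star1 sa.
exists (rnorm a); first exact: rnorm_ge0.
by rewrite opprD addrA subrr sub0r rnormN.
Qed.

End CStarPositive.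

(** * Hilbert spaces *)

Section LinearFunctions.
Variables (K : pzRingType) (U V : lmodType K) (T : U -> V).
Hypothesis linT : linear T.

Lemma lin0 : T 0 = 0.
Proof. by have := linT (-1) 0 0; rewrite !scaleN1r oppr0 addr0 addNr. Qed.

Lemma linZ a x : T (a *: x) = a *: T x.
Proof. by have := linT a x 0; rewrite lin0 !addr0. Qed.

Lemma linD x y : T (x + y) = T x + T y.
Proof. by have := linT 1 x y; rewrite !scale1r. Qed.

Lemma linN x : T (- x) = - T x.
Proof. by rewrite -scaleN1r linZ scaleN1r. Qed.

Lemma linB x y : T (x - y) = T x - T y.
Proof. by rewrite linD linN. Qed.

Lemma lin_sum (I : Type) (r : seq I) (P : pred I) (F : I -> U) :
  T (\sum_(i <- r | P i) F i) = \sum_(i <- r | P i) T (F i).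
Proof. exact: (big_morph _ linD lin0). Qed.

End LinearFunctions.

Section InnerProduct.
Variables (R : realType) (H : hilbertType R).
Implicit Types x y z : H.

Lemma ip_linearl y : linear (fun x => ip x y : R[i]^o).
Proof. by move=> a u v; rewrite /ip linearDl linearZl_LR. Qed.

Lemma ipC x y : ip x y = Num.conj (ip y x).
Proof. by rewrite /ip (hermC (@inner R H) x y) expr0 mul1r. Qed.

Lemma ipDl x y z : ip (x + y) z = ip x z + ip y z.
Proof. exact: linD (ip_linearl z) _ _. Qed.
Lemma ipBl x y z : ip (x - y) z = ip x z - ip y z.
Proof. exact: linB (ip_linearl z) _ _. Qed.
Lemma ipZl a x z : ip (a *: x) z = a * ip x z.
Proof. exact: linZ (ip_linearl z) _ _. Qed.
Lemma ip0l z : ip 0 z = 0.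
Proof. exact: lin0 (ip_linearl z). Qed.
Lemma ip_suml (I : Type) (r : seq I) (F : I -> H) z :
  ip (\sum_(i <- r) F i) z = \sum_(i <- r) ip (F i) z.
Proof. exact: (big_morph (fun x => ip x z) (fun x y =>
  ipDl x y z) (ip0l z)). Qed.
Lemma ipDr x y z : ip z (x + y) = ip z x + ip z y.
Proof. by rewrite ipC ipDl rmorphD /= -!ipC. Qed.
Lemma ipBr x y z : ip z (x - y) = ip z x - ip z y.
Proof. by rewrite ipC ipBl rmorphB /= -!ipC. Qed.
Lemma ipZr a x z : ip z (a *: x) = Num.conj a * ip z x.
Proof. by rewrite ipC ipZl rmorphM /= -ipC. Qed.
Lemma ip0r z : ip z 0 = 0.
Proof. by rewrite ipC ip0l rmorph0. Qed.
Lemma ip_sumr (I : Type) (r : seq I) (F : I -> H) z :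
  ip z (\sum_(i <- r) F i) = \sum_(i <- r) ip z (F i).
Proof. exact: (big_morph (fun x => ip z x) (fun x y =>
  ipDr x y z) (ip0r z)). Qed.

Lemma ipxx x : ip x x = (rnorm x ^+ 2)%:C.
Proof. by rewrite /ip -hnormE rnormE -rmorphXn. Qed.

Lemma ip_inj x y : (forall z, ip z x = ip z y) -> x = y.
Proof.
move=> h; apply/eqP; rewrite -subr_eq0; apply/eqP/rnorm_eq0/eqP.
rewrite -sqrf_eq0; apply/eqP/complexI.
by rewrite -ipxx ipBr h subrr.
Qed.

Lemma parallelogram x y :
  rnorm (x + y) ^+ 2 + rnorm (x - y) ^+ 2 = 2 * (rnorm x ^+ 2 + rnorm y ^+ 2).
Proof.
suff : (rnorm (x + y) ^+ 2 + rnorm (x - y) ^+ 2)%:C =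
       (2 * (rnorm x ^+ 2 + rnorm y ^+ 2))%:C by move/complexI.
have := (ipxx (x + y), ipxx (x - y), ipxx x, ipxx y).
move: (_ ^+ 2) (_ ^+ 2) (_ ^+ 2) (_ ^+ 2) => a b c d [[[ha hb] hc] hd].
rewrite (_ : 2 * (b + a) = b + b + (a + a)); last by ring.
rewrite !rmorphD /= -ha -hb -hc -hd !ipBl !ipBr !ipDl !ipDr.
by ring.
Qed.

(** The perturbation used to show that a nearest point gives an orthogonal remainder; [m] is the
    squared modulus of [ip x y]. *)
Lemma rnorm_sub_scale x y (t m : R) : ip x y * Num.conj (ip x y) = m%:C ->
  rnorm (x - (t%:C * ip x y) *: y) ^+ 2 =
  rnorm x ^+ 2 - 2 * t * m + t ^+ 2 * m * rnorm y ^+ 2.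
Proof.
set c := ip x y => cm.
suff : (rnorm (x - (t%:C * c) *: y) ^+ 2)%:C =
  (rnorm x ^+ 2 - 2 * t * m + t ^+ 2 * m * rnorm y ^+ 2)%:C by move/complexI.
have := (ipxx (x - (t%:C * c) *: y), ipxx x, ipxx y).
rewrite (expr2 t); move: (_ ^+ 2) (_ ^+ 2) (_ ^+ 2) => a b d [[ha hb] hd].
rewrite !rmorphD rmorphN !rmorphM /= -ha -hb -hd -cm.
rewrite ipBl !ipBr !ipZl !ipZr (ipC y x) -/c rmorphM /= conj_Creal
  ?complex_real //.
rewrite (_ : 2%:C = 2 :> R[i]) ?rmorph_nat //.
by ring.
Qed.

End InnerProduct.

Section Operators.
Variables (R : realType) (H K : hilbertType R).
Implicit Types (T : H -> K) (U : K -> H).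

Lemma contraction_bounded T : linear T -> (forall x, `|T x| <= `|x|) ->
  bounded_op T.
Proof.
move=> linT conT; split=> // x; apply/cvgrPdist_le => e e0.
near=> y; rewrite /= -linB //; apply: le_trans (conT _) _.
near: y; have := @cvg_id _ (nbhs x); move/cvgrPdist_le; exact.
Unshelve. all: by end_near.
Qed.

Lemma isometry_bounded T : isometry_op T -> bounded_op T.
Proof. by move=> [linT isoT]; apply: contraction_bounded => // x;
  rewrite isoT. Qed.

Lemma adj_bounded T : bounded_op (adj T).
Proof.
rewrite /adj; case: xgetP => [U _ [] //|_].
by split=> [a x y|x]; [rewrite scaler0 addr0 | exact: cvg_cst].
Qed.

Lemma adjE T U : bounded_op U -> adjoint_of T U -> adj T = U.
Proof.
move=> bU aU; rewrite /adj; case: xgetP => [V _ [_ aV]|/(_ U)]; last by case.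
by apply/funext => y; apply: ip_inj => x; rewrite -aU aV.
Qed.

(* The nearest point of the complete subspace T(H) to d is an orthogonal
   projection of d. *)
Lemma isometry_dense_surj T : isometry_op T ->
  (forall d, (forall x, ip d (T x) = 0) -> d = 0) -> forall d, exists x,
    T x = d.
Proof.
move=> [linT isoT] dT d.
have isor x : rnorm (T x) = rnorm x by rewrite /rnorm isoT.
pose E := [set rnorm (d - T x) ^+ 2 | x in [set: H]].
have hE : has_inf E.
  split; first by exists (rnorm (d - T 0) ^+ 2), 0.
  by exists 0 => _ [x _ <-]; exact: sqr_ge0.
pose del := inf E.
have delP x : del <= rnorm (d - T x) ^+ 2.
  by apply: (ge_inf hE.2); exists x.
have del0 : 0 <= del.
  by apply: lb_le_inf hE.1 _ => _ [x _ <-]; exact: sqr_ge0.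
have /choice [u uP] : forall n : nat, exists x,
  rnorm (d - T x) ^+ 2 < del + n.+1%:R^-1.
  move=> n; have n0 : 0 < n.+1%:R^-1 :> R by rewrite invr_gt0.
  by have [_ [x _ <-] hx] := inf_adherent n0 hE; exists x.
(* The midpoint of [u m] and [u n] also has distance squared at least [del], so the parallelogram
   law makes the minimizing sequence Cauchy. *)
have umn m n : rnorm (u m - u n) ^+ 2 <= 2 * (m.+1%:R^-1 + n.+1%:R^-1).
  have := parallelogram (d - T (u m)) (d - T (u n)).
  have -> : d - T (u m) - (d - T (u n)) = T (u n - u m).
    by rewrite (linB linT) opprB addrC addrA subrK.
  have -> : d - T (u m) + (d - T (u n)) =
      2%:C *: (d - T ((2^-1)%:C *: (u m + u n))).
    rewrite addrACA -opprD -(linD linT) scalerBr (linZ linT) scalerA -rmorphM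
      /= mulfV //.
    rewrite scale1r (_ : 2%:C = 2 :> R[i]) ?rmorph_nat //.
    by rewrite scaler_nat mulr2n.
  rewrite isor rnormZr // exprMn (rnormB (u n)).
  have := delP ((2^-1)%:C *: (u m + u n)); have := uP m; have := uP n.
  move: (_^-1) (_^-1) => a b; lra.
have invn (e : R) : 0 < e -> exists N, forall n, (N <= n)%N -> n.+1%:R^-1 <= e.
  move=> e0; exists (Num.bound e^-1) => n Nn.
  rewrite -[e]invrK lef_pV2 ?posrE ?invr_gt0 //.
  have e1 : 0 <= e^-1 by rewrite invr_ge0 ltW.
  apply: ltW; apply: lt_le_trans (archi_boundP e1) _.
  by rewrite ler_nat leqW.
have [x xl] : exists x, forall e : R, 0 < e -> exists N, forall n, (N <= n)%N ->
    rnorm (u n - x) <= e.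
  apply: rnorm_complete => e e0.
  have e2 : 0 < e ^+ 2 / 4 by rewrite divr_gt0 // exprn_gt0.
  have [N hN] := invn _ e2; exists N => m n Nm Nn.
  rewrite -(@ler_pXn2r _ 2) ?nnegrE ?rnorm_ge0 ?(ltW e0) //.
  apply: le_trans (umn _ _) _; have := hN _ Nm; have := hN _ Nn.
  by move: (n.+1%:R^-1) (m.+1%:R^-1) => a b; lra.
have xmin : rnorm (d - T x) ^+ 2 <= del.
  suff : rnorm (d - T x) ^+ 2 - del <= 0 by lra.
  (* With $a^2 \le del + e'$, $a \le del + 2$ and $e' \le 1$, the square $(a + e')^2$ is at most
     $del + (2\,del + 6) e'$. *)
  apply: (@le0_linear_bound _ (2 * del + 6)) => e e0.
  pose e' := Num.min e 1; have e'0 : 0 < e' by rewrite lt_min e0 ltr01.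
  have e'1 : e' <= 1 by rewrite ge_min lexx orbT.
  have e'e : e' <= e by rewrite ge_min lexx.
  have [N1 hN1] := invn _ e'0; have [N2 hN2] := xl _ e'0.
  pose n := maxn N1 N2.
  have h1 := hN1 n (leq_maxl _ _); have h2 := hN2 n (leq_maxr _ _).
  have h3 : rnorm (d - T (u n)) ^+ 2 < del + e'.
    by apply: lt_le_trans (uP n) _; rewrite lerD2l.
  have h4 : rnorm (d - T x) <= rnorm (d - T (u n)) + e'.
    by apply: le_trans (rnormBD _ (T (u n)) _) _; rewrite lerD2l -linB // isor.
  move: h3 h4 (rnorm_ge0 (d - T x)) (rnorm_ge0 (d - T (u n))).
  set a := rnorm (d - T (u n)); set b := rnorm (d - T x) => h3 h4 b0 a0.
  have a1 : a <= del + 2 by nra.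
  have : b ^+ 2 <= (a + e') ^+ 2 by nra.
  have d2 : 0 <= 2 * del + 6 by lra.
  have : (2 * del + 6) * e' <= (2 * del + 6) * e by rewrite ler_wpM2l.
  nra.
exists x; apply/eqP; rewrite eq_sym -subr_eq0; apply/eqP/dT => g.
set c := ip _ _.
have [m m0 cm] : exists2 m : R, 0 <= m & c * Num.conj c = m%:C.
  exists (rnorm (c : R[i]^o) ^+ 2); first exact: sqr_ge0.
  by rewrite -normCK rmorphXn /= -rnormE.
have G0 := sqr_ge0 (rnorm (T g)).
(* For this step the quadratic term is at most half of the linear decrease $2tm$, so minimality
   forces $m = 0$. Adding 1 covers [T g = 0]. *)
pose t := (rnorm (T g) ^+ 2 + 1)^-1.
have t0 : 0 < t by rewrite invr_gt0; lra.
have tG : t * rnorm (T g) ^+ 2 <= 1.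
  rewrite /t ler_pdivrMl; lra.
have := delP (x + (t%:C * c) *: g).
rewrite linD // linZ // opprD addrA (rnorm_sub_scale t cm) => h.
have tm : (t * m) * (t * rnorm (T g) ^+ 2) <= t * m.
  by rewrite ler_piMr // mulr_ge0 // ltW.
have m00 : m = 0.
  apply/le_anti; rewrite m0 andbT -(pmulr_rle0 _ t0).
  by move: h xmin tm; set a := _ ^+ 2; set b := rnorm (T g) ^+ 2; lra.
by move: cm; rewrite m00 -normCK => /eqP; rewrite sqrf_eq0 normr_eq0 => /eqP.
Qed.

End Operators.

(** * Self-adjoint elements and the cone Xi *)

Section SelfAdjointElements.
Variables (R : realType) (S : opsys R).
Implicit Types s : S.

Definition os_sa s := star (os_emb S s) = os_emb S s.

Lemma os_sa_one : os_sa (os_one S).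
Proof. by rewrite /os_sa os_oneE star1. Qed.

Lemma os_saD s t : os_sa s -> os_sa t -> os_sa (s + t).
Proof. by rewrite /os_sa => hs ht; rewrite linearD starD hs ht. Qed.

Lemma os_saZ (a : R) s : os_sa s -> os_sa (a%:C *: s).
Proof. by rewrite /os_sa => hs; rewrite linearZ /= starZr hs. Qed.

Lemma os_saDstar s : os_sa (s + os_star s).
Proof. by rewrite /os_sa linearD /= starD !os_starE starK addrC. Qed.

Lemma os_saBstar s : os_sa ('i *: (os_star s - s)).
Proof.
rewrite /os_sa linearZ linearB /= starZ starB !os_starE starK conjCi.
by rewrite scaleNr -scalerN opprB.
Qed.

Lemma cpos_os_shift s : os_sa s ->
  cpos (os_emb S ((rnorm (os_emb S s))%:C *: os_one S + s)).
Proof. by move=> hs; rewrite linearD linearZ /= os_oneE;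
  exact: cpos_rnormD. Qed.

Lemma ucp_cpos (H : hilbertType R) (phi : S -> H -> H) s xi :
  ucp phi -> cpos (os_emb S s) -> 0 <= ip (phi s xi) xi.
Proof.
move=> [_ _ _ phip] [y sy].
have := phip 1%N (const_mx s) _ (fun=> xi).
rewrite !big_ord1 mxE; apply; exists (const_mx y); apply/matrixP => i k.
by rewrite !mxE big_ord1 !mxE sy.
Qed.

(** Shifting [s] by its norm makes it positive, and [phi] is unital, so the value is a nonnegative
    number minus a real one. *)
Lemma ucp_real (H : hilbertType R) (phi : S -> H -> H) s xi :
  ucp phi -> os_sa s -> ip (phi s xi) xi \is Num.real.
Proof.
move=> uphi hs; have := ucp_cpos xi uphi (cpos_os_shift hs).
case: uphi => linphi _ phi1 _; rewrite (linD linphi) (linZ linphi) phi1 /= => h.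
have := ger0_real h.
rewrite -[(_ + _) xi]/((rnorm (os_emb S s))%:C *: xi + phi s xi).
rewrite ipDl ipZl ipxx -rmorphM /= addrC => h2.
by rewrite -(rpredDr _ (_ : (rnorm (os_emb S s) * rnorm xi ^+ 2)%:C \is
  Num.real)) //
  complex_real.
Qed.

(* Polarization of the real quadratic form xi |-> <phi(s) xi, xi>. *)
Lemma ucp_selfadjoint (H : hilbertType R) (phi : S -> H -> H) s :
  ucp phi -> os_sa s -> adjoint_of (phi s) (phi s).
Proof.
move=> uphi hs x y.
have B z := ucp_real z uphi hs.
have linT : linear (phi s) by case: uphi => _ b _ _; case: (b s).
have h1 := B (x + y); have h2 := B (x + 'i *: y).
rewrite !(linD linT) (linZ linT) !ipDl !ipDr !ipZl !ipZr conjCi in h1 h2.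
have Bx := B x; have By := B y.
move: h1 h2 Bx By; rewrite [ip x _]ipC.
set a := ip (phi s x) y; set b := ip (phi s y) x.
set c := ip (phi s x) x;
  set d := ip (phi s y) y => /CrealP h1 /CrealP h2 /CrealP hc /CrealP hd.
move: h1 h2; rewrite !rmorphD !rmorphM !rmorphN /= conjCi hc hd => h1 h2.
have ii : 'i * 'i = -1 :> R[i] by rewrite -expr2 sqrCi.
have e1 : Num.conj a + Num.conj b = a + b.
  apply: (addrI (c + d)); apply: etrans (etrans _ h1) _; ring.
have e2 : 'i * (Num.conj a - Num.conj b) = 'i * (b - a) :> R[i].
  apply: (addrI (c + - ('i * 'i) * d)); apply: etrans (etrans _ h2) _; ring.
have e3 := mulfI (neq0Ci _) e2.
have two : 2 != 0 :> R[i] by rewrite pnatr_eq0.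
apply: (mulfI two).
have : 2 * Num.conj b = 2 * a.
  rewrite (_ : 2 * Num.conj b = (Num.conj a + Num.conj b) - (Num.conj a -
    Num.conj b)); last by ring.
  by rewrite e1 e3; ring.
by move=> ->.
Qed.

End SelfAdjointElements.

Section Isometries.
Variables (R : realType) (H K L : hilbertType R).

Lemma bounded_comp (T : H -> K) (U : K -> L) :
  bounded_op T -> bounded_op U -> bounded_op (U \o T).
Proof.
move=> [lT cT] [lU cU]; split; first by move=> a x y; rewrite /= lT lU.
by move=> x; apply: continuous_comp; [exact: cT | exact: cU].
Qed.

Lemma ip_isometry (T : H -> K) : linear T ->
  (forall x y, ip (T x) (T y) = ip x y) -> isometry_op T.
Proof.
move=> lT ipT; split=> // x; rewrite !rnormE; congr (_%:C).
apply/eqP; rewrite -(@eqrXn2 _ 2) ?rnorm_ge0 //; apply/eqP/complexI.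
by rewrite -!ipxx ipT.
Qed.

(** The inverse of [T] is isometric, hence a bounded adjoint, and [adjE] identifies the chosen
    adjoint with it. *)
Lemma adj_surj_isometry (T : H -> K) : linear T ->
  (forall x y, ip (T x) (T y) = ip x y) -> (forall d, exists x, T x = d) ->
  cancel T (adj T) /\ cancel (adj T) T.
Proof.
move=> lT ipT sT; have [_ isoT] := ip_isometry lT ipT.
have [U UK] := choice sT.
have injT x y : T x = T y -> x = y.
  move=> h; apply: ip_inj => z.
  by rewrite -!ipT h.
have -> : adj T = U.
  apply: adjE; last by move=> x y; rewrite -{1}[y]UK ipT.
  apply: isometry_bounded; split; last by move=> d; rewrite -isoT UK.
  by move=> a x y; apply: injT; rewrite UK lT !UK.
by split=> [x|] //; apply: injT; rewrite UK.
Qed.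

End Isometries.

(** * Evaluation at a self-adjoint element as an nc function with a one-point index set *)

Section OneDimensionalAmplification.
Variables (R : realType) (S : opsys R) (W : nc_frame S) (m : nc_card W)
  (i0 : nc_idx m).
Hypothesis i0P : forall i : nc_idx m, i = i0.

Let J n : nc_sp n -> nc_amp m n := nc_inj i0.

Let linJ n : linear (@J n).
Proof. by case: (nc_ampP m n) => h _ _; exact: h. Qed.

Let ipJ n x y : ip (@J n x) (J y) = ip x y.
Proof. by case: (nc_ampP m n) => _ h _; rewrite h eqxx. Qed.

Let isoJ n : isometry_op (@J n).
Proof. exact: ip_isometry (@linJ n) (@ipJ n). Qed.

Let surjJ n d : exists x, @J n x = d.
Proof.
apply: isometry_dense_surj (isoJ n) _ _ => e he; case: (nc_ampP m n) => _ _;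
  apply.
by move=> i x; rewrite (i0P i); exact: he.
Qed.

Let JK n : cancel (@J n) (adj (@J n)).
Proof. by case: (adj_surj_isometry (@linJ n) (@ipJ n) (@surjJ n)). Qed.

Let JVK n : cancel (adj (@J n)) (@J n).
Proof. by case: (adj_surj_isometry (@linJ n) (@ipJ n) (@surjJ n)). Qed.

(** [nc_tensor] is a choice among operators with prescribed values on the range of [J]; that range
    is everything, so the choice is forced. *)
Lemma nc_tensor1 n n' (alpha : nc_sp n -> nc_sp n') : bounded_op alpha ->
  @nc_tensor _ _ W m n n' alpha = @J n' \o alpha \o adj (@J n).
Proof.
move=> ba; rewrite /nc_tensor; case: xgetP => [T _ [bT hT]|].
  by apply/funext => d; rewrite -{1}(JVK d) /J hT.
move=> /(_ (@J n' \o alpha \o adj (@J n))); case; split.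
  by apply: bounded_comp (adj_bounded _) (bounded_comp ba (isometry_bounded
    (isoJ n'))).
by move=> i x; rewrite (i0P i) /= -/(J x) JK.
Qed.

Variable s0 : S.
Hypothesis s0_sa : os_sa s0.

(** Even for a single index the values must act on [nc_amp m n], which is only unitarily equivalent
    to [nc_sp n] through [J]; hence the conjugation. *)
Definition nc_eval : nc_family m := fun n x => @J n \o x s0 \o adj (@J n).

Lemma nc_eval_fun : is_nc_fun nc_eval.
Proof.
split.
- move=> n x [_ bx _ _].
  exact: bounded_comp (adj_bounded _) (bounded_comp (bx s0) (isometry_bounded
    (isoJ n))).
- move=> n I nu x alpha y xK aI _ yK hs d.
  have := hs s0 (adj (@J n) d).
  set g := fun i => (alpha i \o x i s0 \o adj (alpha i)) (adj (@J n) d).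
  have -> : (fun i => (@nc_tensor _ _ W m _ _ (alpha i) \o nc_eval (x i) \o
               @nc_tensor _ _ W m _ _ (adj (alpha i))) d) = fun i => J (g i).
    apply/funext => i; rewrite !nc_tensor1; last exact: isometry_bounded.
      by rewrite /= !JK.
    exact: adj_bounded.
  move=> hg.
  have -> : summability.partial_sum (fun i => J (g i)) =
            @J n \o summability.partial_sum g.
    by apply/funext => A;
      rewrite /summability.partial_sum /= (lin_sum (@linJ n)).
  apply: cvg_comp hg _; rewrite /nc_eval /=.
  by case: (isometry_bounded (isoJ n)) => _; exact.
- move=> n x beta xK [bI _]; rewrite !nc_tensor1; last exact: isometry_bounded.
    by apply/funext => d; rewrite /nc_eval /= !JK.
  exact: adj_bounded.
Qed.

Lemma nc_eval_selfadjoint : nc_selfadjoint nc_eval.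
Proof.
move=> n x xK u v; rewrite /nc_eval /= -{1}(JVK v) ipJ (ucp_selfadjoint xK
  s0_sa).
by rewrite -{2}(JVK u) ipJ.
Qed.

Lemma nc_eval_convex : nc_convex nc_eval.
Proof.
move=> n x y t xK yK t01 u.
rewrite (_ : _ - _ = 0) ?ip0l //; apply/eqP; rewrite subr_eq0 eq_sym; apply/eqP.
by rewrite /nc_eval /= (linD (@linJ n)) !(linZ (@linJ n)).
Qed.

Lemma nc_eval_entry i k n (x : S -> nc_sp n -> nc_sp n) :
  nc_entry nc_eval i k x = x s0.
Proof.
by apply/funext => d; rewrite (i0P i) (i0P k) /nc_entry /nc_eval /= !JK.
Qed.

Lemma nc_eval_continuous : nc_continuous nc_eval.
Proof.
move=> i k n x xK B [xi [e [xis e0 hB]]].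
exists [fset s0]%fset, xi, e; split=> // psi psiK hpsi.
rewrite /= nc_eval_entry; apply: hB; first by case: psiK.
by rewrite nc_eval_entry; apply: hpsi; rewrite inE.
Qed.

Lemma Xi_selfadjoint_eval (C : cstarType R)
    (hat : forall n : nc_card W, (S -> nc_sp n -> nc_sp n) ->
           C -> nc_sp n -> nc_sp n) (b : C) :
  (forall n (x : S -> nc_sp n -> nc_sp n), nc_K x -> hat n x b = x s0) ->
  Xi hat b.
Proof.
move=> hb; exists m, nc_eval, [fset i0]%fset, (fun=> 1), (fun _ _ => b); split.
- exact: nc_eval_fun.
- exact: nc_eval_selfadjoint.
- exact: nc_eval_convex.
- exact: nc_eval_continuous.
split; last by rewrite !big_seq_fset1 rmorph1 mulr1 scale1r.
by move=> i k n x _ _ xK; rewrite /nc_Phi hb // nc_eval_entry.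
Qed.

End OneDimensionalAmplification.

(** * States *)

Section States.
Variables (R : realType) (S : opsys R).
Implicit Types (s : S) (f : {ptws S -> R[i]^o}).

Lemma state_linear f : states f -> linear (f : S -> R[i]^o).
Proof. by case. Qed.

Lemma state_real f s : states f -> os_sa s -> f s \is Num.real.
Proof.
move=> [linf f1 fp] hs; have := ger0_real (fp _ (cpos_os_shift hs)).
rewrite (linD linf) (linZ linf) f1 => h.
by move: h; rewrite [_ *: _]mulr1 rpredDl ?complex_real.
Qed.

Lemma state_sa_bound f s : states f -> os_sa s ->
  rnorm (f s) <= rnorm (os_emb S s).
Proof.
move=> sf hs.
have bound t : os_sa t -> 0 <= (rnorm (os_emb S t))%:C + f t.
  case: sf => linf f1 fp /cpos_os_shift/fp.
  by rewrite (linD linf) (linZ linf) f1 [_ *: _]mulr1.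
have hsN : os_sa (- s) by rewrite /os_sa linearN starN hs.
have := bound _ hs; have := bound _ hsN.
rewrite linearN rnormN (linN (state_linear sf)).
rewrite /rnorm; have /complex_realP[r ->] := state_real sf hs.
rewrite -rmorphB -rmorphD /= !ler0c => h1 h2.
by rewrite expr0n addr0 sqrtr_sqr ler_norml; apply/andP; split; lra.
Qed.

(** The factor 2 comes from $2s = a + ib$ with $a$, $b$ self-adjoint of norm at most $2|s|$. A bound
    uniform in the state is what [state_dual] and compactness call for. *)
Lemma state_bound f s : states f -> rnorm (f s) <= 2 * rnorm (os_emb S s).
Proof.
move=> sf; have linf := state_linear sf.
pose a := s + os_star s; pose b := 'i *: (os_star s - s).
have e : s + s = a + 'i *: b.
  by rewrite scalerA -expr2 sqrCi scaleN1r opprB addrACA subrr addr0.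
have na : rnorm (os_emb S a) <= 2 * rnorm (os_emb S s).
  rewrite linearD /= os_starE; apply: le_trans (rnormD _ _) _.
  by rewrite rnorm_star; lra.
have nb : rnorm (os_emb S b) <= 2 * rnorm (os_emb S s).
  rewrite linearZ /= linearB /= os_starE rnormZ normCi mul1r.
  apply: le_trans (rnormD _ _) _.
  by rewrite rnormN rnorm_star; lra.
have fa := state_sa_bound sf (os_saDstar s).
have fb := state_sa_bound sf (os_saBstar s).
have : rnorm (f s + f s) <= rnorm (f a) + rnorm (f b).
  rewrite -(linD linf) e (linD linf) (linZ linf).
  by apply: le_trans (rnormD _ _) _; rewrite rnormZ normCi mul1r.
have -> : rnorm (f s + f s) = 2 * rnorm (f s).
  rewrite -mulr2n -scaler_nat (_ : 2%:R = 2%:C :> R[i]);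
    last by rewrite rmorph_nat.
  by rewrite rnormZr.
by rewrite -/a -/b in fa fb; lra.
Qed.

Lemma state_dual f : states f -> dual f.
Proof.
move=> sf; split; first exact: state_linear.
exists 2%:C => s; rewrite !rnormE -rmorphM /= lecR.
exact: state_bound.
Qed.

(** [F n] is the [n]-th entry of the column $Ya$, so compressing $Y^* Y$ by the scalar column $a$
    gives the sum of the [star (F n) * F n], to which [cpos_sum_star_mul] applies. *)
Lemma state_cpos_sum k (X : 'M[S]_k) (a : 'I_k -> R[i]) f : states f ->
  mxpos (map_mx (os_emb S) X) ->
  0 <= \sum_i \sum_l (Num.conj (a i) * a l) *: (f (X i l) : R[i]^o).
Proof.
move=> [linf _ fp] [Y XY].
pose p := \sum_i \sum_l (Num.conj (a i) * a l) *: X i l.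
have -> : \sum_i \sum_l (Num.conj (a i) * a l) *: (f (X i l) : R[i]^o) = f p.
  rewrite (lin_sum linf); apply: eq_bigr => i _.
  by rewrite (lin_sum linf); apply: eq_bigr => l _; rewrite (linZ linf).
apply: fp; pose F (n : 'I_k) := \sum_l a l *: Y n l.
suff -> : os_emb S p = \sum_n star (F n) * F n by exact: cpos_sum_star_mul.
have XE i l : os_emb S (X i l) = \sum_n star (Y n i) * Y n l.
  have /matrixP/(_ i l) := XY; rewrite !mxE => ->.
  by apply: eq_bigr => n _; rewrite !mxE.
rewrite linear_sum /=.
under eq_bigr do rewrite linear_sum /=.
under [RHS]eq_bigr do rewrite star_sum mulr_suml.
rewrite exchange_big /= [RHS]exchange_big /=.
rewrite exchange_big /=; apply: eq_bigr => i _.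
under [RHS]eq_bigr do rewrite mulr_sumr.
rewrite [RHS]exchange_big /=; apply: eq_bigr => l _.
rewrite linearZ /= XE scaler_sumr; apply: eq_bigr => n _.
by rewrite starZ -scalerAl -scalerAr scalerA.
Qed.

End States.

(** * Characters of $C^*$-algebras *)

Section CharacterContraction.
Variables (R : realType) (A : cstarType R).

Record is_star_character (chi : A -> R[i]^o) : Prop := {
  char_linear : linear chi ;
  char1 : chi 1 = 1 ;
  charM : forall a b, chi (a * b) = chi a * chi b ;
  char_star : forall a, chi (star a) = Num.conj (chi a) }.

(** $|a|^2 - a^* a$ has the form [star y * y], and a character maps it to the squared modulus of
    [chi y]. *)
Lemma star_character_contractive chi a : is_star_character chi ->
  rnorm (chi a) <= rnorm a.
Proof.
move=> [lchi chi1 chiM chis].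
have hs : star (- (star a * a)) = - (star a * a) by rewrite starN starM starK.
have [y hy] := cpos_rnormD hs.
have : 0 <= chi (star y * y) by rewrite chiM chis mulrC -normCK exprn_ge0.
rewrite -hy (linD lchi) (linZ lchi) chi1 (linN lchi) chiM chis.
rewrite rnormN rnorm_starM mulrC -normCK rnormE -rmorphXn /=.
rewrite [_ *: _]mulr1 -rmorphB ler0c subr_ge0.
by rewrite ler_pXn2r ?nnegrE ?rnorm_ge0.
Qed.

(** The agreement set is a self-adjoint subalgebra containing [E], and contractivity of both
    characters makes it closed. *)
Lemma star_character_eq (E : set A) chi1 chi2 : cstar_generates E ->
  is_star_character chi1 -> is_star_character chi2 ->
  (forall a, E a -> chi1 a = chi2 a) -> chi1 = chi2.
Proof.
move=> genE h1 h2 eqE.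
suff : [set a | chi1 a = chi2 a] = setT.
  by move=> e; apply/funext => a; have : [set: A] a by []; rewrite -e.
have l1 := char_linear h1; have l2 := char_linear h2.
apply: genE => //=.
- move=> a acl; apply: (@rnorm_eq_small _ _ 2) => e e0.
  have [b [/= hb]] : [set a | chi1 a = chi2 a] `&` ball a e%:C !=set0.
    by apply: acl; apply: nbhsx_ballx; rewrite (ltcR 0 e).
  rewrite -ball_normE /= rnormE ltcR => ab.
  apply: le_trans (rnormBD _ (chi1 b) _) _.
  have := star_character_contractive (a - b) h1.
  have := star_character_contractive (b - a) h2.
  by rewrite {2}hb -!linB // (rnormB b); lra.
- by move=> x y hx hy; rewrite (linD l1) (linD l2) hx hy.
- by move=> x y hx hy; rewrite (charM h1) (charM h2) hx hy.
- by move=> a x hx; rewrite (linZ l1) (linZ l2) hx.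
- by move=> x hx; rewrite (char_star h1) (char_star h2) hx.
Qed.

End CharacterContraction.

(** The cardinal 1 is obtained from a singleton in [kappa], which is inhabited because it is
    infinite. *)
Lemma nc_card_one (R : realType) (S : opsys R) (W : nc_frame S) :
  exists (n : nc_card W) (i0 : nc_idx n), forall i, i = i0.
Proof.
have [k _] : [set: kappa W] !=set0.
  by apply/set0P/eqP => k0; apply: (@kappa_infinite _ _ W); rewrite k0;
    exact: finite_set0.
have [n /card_eqPle [/card_leP[f] _]] : exists n : nc_card W,
  ([set: nc_idx n] #= [set k])%card.
  by apply: nc_idx_surj; exists k.
have [i0 _] := nc_idx_neq0 n; exists n, i0 => i.
pose u (x : nc_idx n) : [set: nc_idx n] := SigSub (mem_set (I : [set: nc_idx
  n] x)).
have fi : f (u i) = f (u i0).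
  by apply: val_inj; rewrite (set_valP (f (u i))) (set_valP (f (u i0))).
have := 'inj_f (in_setT (u i)) (in_setT (u i0)) fi.
by move/(congr1 val).
Qed.

(** * States and representations on the line spanned by a unit vector *)

Section OneDimensionalRepresentation.
Variables (R : realType) (S : opsys R) (H : hilbertType R) (e : H).
Hypothesis ee : ip e e = 1.
Hypothesis eH : forall x, x = ip x e *: e.

Definition state_op (f : {ptws S -> R[i]^o}) : S -> H -> H := fun s x =>
  f s *: x.

Lemma scale_bounded (a : R[i]) : bounded_op (fun x : H => a *: x).
Proof.
split; first by move=> b x y; rewrite scalerDr !scalerA mulrC.
by move=> x; apply: cvgZr; exact: cvg_id.
Qed.

Lemma state_ucp f : states f -> ucp (state_op f).
Proof.
move=> sf; have linf := state_linear sf; split.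
- move=> a s t; apply/funext => x.
  by rewrite /state_op linf -[RHS]/(a *: (f s *: x) + f t *: x) scalerDl
    scalerA.
- by move=> s; exact: scale_bounded.
- by apply/funext => x; rewrite /state_op; case: sf => _ -> _; rewrite scale1r.
move=> k X Xpos xi.
rewrite (_ : \sum_i _ = \sum_i \sum_l
  (Num.conj (ip (xi i) e) * ip (xi l) e) *: (f (X i l) : R[i]^o)).
  exact: state_cpos_sum.
apply: eq_bigr => i _; apply: eq_bigr => l _.
rewrite /state_op {1}(eH (xi l)) {1}(eH (xi i)) ipZl ipZr ipZl ee mulr1.
exact: mulrC.
Qed.

Variables (C : cstarType R) (pi : C -> H -> H).
Hypothesis pi_rep : is_star_rep pi.

(** Multiplicativity holds because [pi b e] is a multiple of [e]. *)
Lemma rep_character : is_star_character (fun a => ip (pi a e) e : R[i]^o).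
Proof.
case: pi_rep => lpi bpi pi1 piM pis; split.
- by move=> a x y; rewrite lpi -[LHS]/(ip (a *: pi x e + pi y e) e) ipDl ipZl.
- by rewrite pi1.
- move=> a b; rewrite piM /= {1}(eH (pi b e)).
  have [la _] := bpi a.
  by rewrite (linZ la) ipZl mulrC.
- by move=> a; rewrite ipC -pis -ipC.
Qed.

End OneDimensionalRepresentation.

(** Expanding $0 \le |d - TUd|^2$ gives $|d|^2 - |Ud|^2$, so $U$ is a contraction. *)
Lemma adjoint_isometry_bounded (R : realType) (H K : hilbertType R)
    (T : H -> K) (U : K -> H) :
  (forall x y, ip (T x) (T y) = ip x y) -> linear U -> adjoint_of T U ->
  bounded_op U.
Proof.
move=> ipT linU TU; apply: contraction_bounded => // d.
rewrite !rnormE lecR -(@ler_pXn2r _ 2) ?nnegrE ?rnorm_ge0 // -lecR -!ipxx.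
have : 0 <= ip (d - T (U d)) (d - T (U d)) by rewrite ipxx ler0c sqr_ge0.
rewrite !ipBr !ipBl ipT (ipC d (T _)) !TU -ipC.
by rewrite ipxx subrr subr0 subr_ge0.
Qed.

(** * The image of the cone under the quotient map *)

Section ImageOfXi.
Variables (R : realType) (S : opsys R) (W : nc_frame S) (Cmax : cstarType R)
  (j : S -> Cmax)
  (hat : forall n : nc_card W, (S -> nc_sp n -> nc_sp n) ->
         Cmax -> nc_sp n -> nc_sp n)
  (q : Cmax -> state_space S -> R[i]^o).
Hypotheses (jgen : cstar_generates (range j))
  (hatP : forall (n : nc_card W) (phi : S -> nc_sp n -> nc_sp n), nc_K phi ->
     is_star_rep (@hat n phi) /\ forall s, @hat n phi (j s) = phi s)
  (qhom : is_star_hom_CL q) (qj : forall s, q (j s) = state_eval s).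

Lemma nc_line : exists (n : nc_card W) (e : nc_sp n),
  ip e e = 1 /\ forall x, x = ip x e *: e.
Proof.
have [n [i0 i0P]] := nc_card_one W.
have [e [ee emax]] := nc_sp_dim n.
exists n, (e i0); have e1 : ip (e i0) (e i0) = 1 by rewrite ee eqxx.
split=> // x; apply/eqP; rewrite -subr_eq0; apply/eqP/emax => i.
by rewrite (i0P i) ipBl ipZl e1 mulr1 subrr.
Qed.

Lemma hom_character (f : state_space S) : is_star_character (fun a => q a f).
Proof.
case: qhom => _ lq [q1 qM] qs; split.
- by move=> a x y; rewrite lq.
- by rewrite q1.
- by move=> a b; rewrite qM.
- by move=> a; rewrite qs.
Qed.

Lemma state_spaceP (f : state_space S) : states (set_val f).
Proof. exact: set_valP. Qed.

(** For fixed [f] both sides are characters in [a] with value $f(s)$ at [j s], and these elements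
    generate. *)
Lemma q_hatE n (e : nc_sp n) : ip e e = 1 -> (forall x, x = ip x e *: e) ->
  forall f a, q a f = ip (@hat n (state_op (set_val f)) a e) e.
Proof.
move=> ee eH f a.
have [rep hatj] := hatP (state_ucp ee eH (state_spaceP f)).
have := star_character_eq jgen (hom_character f) (rep_character ee eH rep).
move/(_ _)/(congr1 (fun chi => chi a)); apply => _ [s _ <-].
by rewrite qj hatj /state_op ipZl ee mulr1.
Qed.

Lemma q_Xi_Gamma b : Xi hat b -> Gamma (q b).
Proof.
move=> [m [F [I [c [g [Ffun Fsa Fconv _ [gF ->]]]]]]].
have [n [e [ee eH]]] := nc_line.
pose xs (f : state_space S) := state_op (set_val f) : S -> nc_sp n -> nc_sp n.
have xsK f : nc_K (xs f) by exact (state_ucp ee eH (state_spaceP f)).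
pose J i : nc_sp n -> nc_amp m n := nc_inj i.
have [linJ ipJ _] := nc_ampP m n.
(* At level 1 the sum defining an element of the cone is the quadratic form of [F] at this vector $c
   \otimes e$. *)
pose v := \sum_(k <- I) c k *: J k e.
have adjJ i : adj (J i) = fun d => ip d (J i e) *: e.
  have lU : linear (fun d => ip d (J i e) *: e).
    by move=> a x y; rewrite ipDl ipZl scalerDl scalerA.
  have aU : adjoint_of (J i) (fun d => ip d (J i e) *: e).
    move=> x y; rewrite /J ipZr {1}(eH x) (linZ (linJ i)) ipZl mulrC;
      congr (_ * _).
    by rewrite -ipC.
  apply: adjE => //; apply: adjoint_isometry_bounded (J i) _ _ lU aU => x y.
  by rewrite ipJ eqxx.
set b0 := \sum_(_ <- _) _.
have qE f : q b0 f = ip (F n (xs f) v) v.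
  have [bF _] := nc_bounded Ffun (xsK f).
  have lq := char_linear (hom_character f).
  rewrite /b0 (lin_sum lq) {2}/v ip_sumr.
  apply: eq_big_seq => i iI;
    rewrite (lin_sum lq) ipZr {1}/v (lin_sum bF) ip_suml.
  rewrite mulr_sumr; apply: eq_big_seq => k kI.
  rewrite (linZ lq) (linZ bF) ipZl (q_hatE ee eH).
  have := gF i k n (xs f) iI kI (xsK f); rewrite /nc_Phi -/(xs f) => ->.
  rewrite /nc_entry -!/(J _) adjJ /= ipZl ee mulr1.
  rewrite -[LHS]/(c k * Num.conj (c i) * ip (F n (xs f) (J k e)) (J i e)).
  by rewrite mulrA (mulrC (Num.conj _)).
split.
  split; first exact: hom_CL qhom _.
  move=> f; rewrite qE; apply/CrealP.
  by rewrite -ipC (Fsa _ _ (xsK f)).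
move=> f1 f2 f3 t t01 f3E; rewrite !qE.
have xE : xs f3 = t%:C *: xs f1 + (1 - t)%:C *: xs f2.
  apply/funext => s; apply/funext => x; rewrite /xs /state_op f3E.
  rewrite -[RHS]/(t%:C *: (_ *: x) + (1 - t)%:C *: (_ *: x)).
  by rewrite !scalerA -scalerDl.
have := Fconv n _ _ t (xsK f1) (xsK f2) t01 v.
rewrite -xE ipBl.
rewrite -[(t%:C *: _ + _) v]/(t%:C *: F n (xs f1) v + (1 - t)%:C *: F n (xs
  f2) v).
by rewrite ipDl !ipZl subr_ge0.
Qed.

Lemma Xi_sa s : os_sa s -> Xi hat (j s).
Proof.
move=> hs; have [m [i0 i0P]] := nc_card_one W.
by apply: (Xi_selfadjoint_eval i0P hs) => n x xK; case: (hatP xK).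
Qed.

(** The preimage is [j s1], with [s1] the real part of [s] plus [c] times the unit; states are real
    on self-adjoint elements, so they map the real part of [s] to the real part of the value at
    [s]. *)
Lemma q_Xi_affine s (c : R) :
  (q @` Xi hat) (fun f => (complex.Re (state_eval s f) + c)%:C).
Proof.
pose s1 := (2^-1)%:C *: (s + os_star s) + c%:C *: os_one S.
have s1sa : os_sa s1.
  by apply/os_saD/os_saZ/os_sa_one/os_saZ/os_saDstar.
exists (j s1); first exact: Xi_sa.
rewrite qj; apply/funext => f; rewrite /state_eval.
have sf := state_spaceP f; move: (set_val f) sf => g sg.
have lg := state_linear sg; have g1 : g (os_one S) = 1 by case: sg.
rewrite /s1 (linD lg) (linZ lg c%:C) g1 rmorphD; congr (_ + _);
  last exact: mulr1.
pose a := s + os_star s; pose b := 'i *: (os_star s - s).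
have ga : (2^-1)%:C *: g a \is Num.real.
  by rewrite -(linZ lg); apply: state_real => //; apply/os_saZ/os_saDstar.
have gb : (2^-1)%:C *: g b \is Num.real.
  by rewrite -(linZ lg); apply: state_real => //; apply/os_saZ/os_saBstar.
have e : s = (2^-1)%:C *: a + 'i *: ((2^-1)%:C *: b).
  have -> : 'i *: ((2^-1)%:C *: b) = (2^-1)%:C *: (s - os_star s).
    rewrite !scalerA mulrAC -expr2 sqrCi mulrC mulrN1 scaleNr -scalerN opprB //.
  rewrite -scalerDr /a addrACA subrr addr0 scalerDr -scalerDl -rmorphD.
  by rewrite (_ : 2^-1 + 2^-1 = 1) ?scale1r //; lra.
rewrite -/a {1}e (linD lg) (linZ lg 'i) !(linZ lg (2^-1)%:C).
have /complex_realP[r1 ->] := ga; have /complex_realP[r2 ->] := gb.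
have -> : 'i *: (r2%:C : R[i]^o) = 0 +i* r2.
  by rewrite -[LHS]/('i * r2%:C); simpc.
by rewrite /= addr0.
Qed.

End ImageOfXi.

(** * Weak-* continuous affine functions *)

Section PointwiseNeighbourhoods.
Variables (R : realType) (T : choiceType).
Implicit Types f g : {ptws T -> R[i]^o}.

Lemma ptws_nbhs_eval f s (e : R) : 0 < e ->
  nbhs f [set g : {ptws T -> R[i]^o} | rnorm (g s - f s : R[i]^o) <= e].
Proof.
move=> e0; have h : (fun g : {ptws T -> R[i]^o} =>
  g s : R[i]^o) @ f --> (f s : R[i]^o).
  exact: (@proj_continuous T (fun _ => R[i]^o) s f).
have e0' : 0 < e%:C by rewrite (ltcR 0 e).
have /(_ _ e%:C e0') := iffLR (cvgrPdist_le _ _) h.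
by apply: filterS => g /=; rewrite rnormE lecR rnormB.
Qed.

(** The pointwise topology is a supremum of initial topologies, so the filter of finite boxes
    converges to [f] as soon as it does in each coordinate. *)
Lemma ptws_nbhs_basis f A : nbhs f A -> exists (X : seq T) (e : R), 0 < e /\
  forall g : {ptws T -> R[i]^o},
    (forall s, s \in X -> rnorm (g s - f s : R[i]^o) <= e) -> A g.
Proof.
pose B (p : seq T * R) := [set g : {ptws T -> R[i]^o} |
  forall s, s \in p.1 -> rnorm (g s - f s : R[i]^o) <= p.2].
pose D := [set p : seq T * R | 0 < p.2].
have FB : Filter (filter_from D B).
  apply: filter_from_filter; first by exists ([::], 1); exact: ltr01.
  move=> [X e] [Y d] /= e0 d0; exists (X ++ Y, Num.min e d).
    by rewrite /D /= lt_min e0 d0.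
  move=> g hg; split=> s sX; have := hg s; rewrite mem_cat sX ?orbT => /(_ isT);
    by rewrite le_min => /andP[].
suff : filter_from D B --> f.
  by move=> /[apply] -[[X e] e0 h]; exists X, e.
apply/cvg_sup => s U [_ [[V oV <-] /= Vf VU]].
have /nbhs_ballP[e /= e0 eV] : nbhs (f s : R[i]^o) V by exact: open_nbhs_nbhs.
have [r re] : exists r, e = r%:C by apply/complex_realP; exact: gtr0_real.
have r0 : 0 < r by rewrite -ltcR -re.
exists ([:: s], r / 2); first by rewrite /D /= divr_gt0.
move=> g /= hg; apply: VU; apply: eV.
rewrite -ball_normE /= rnormE re ltcR rnormB.
by apply: le_lt_trans (hg s _) _;
  [rewrite inE | rewrite ltr_pdivrMr // ltr_pMr // ltr1n].
Qed.

End PointwiseNeighbourhoods.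

Section WeakStarFunctionals.
Variables (R : realType) (S : opsys R).
Implicit Types f g : S -> R[i]^o.

Lemma dualP (a : R[i]) f g : dual (f : {ptws S -> R[i]^o}) ->
  dual (g : {ptws S -> R[i]^o}) -> dual (a *: f + g : {ptws S -> R[i]^o}).
Proof.
move=> [lf [M fM]] [lg [N gN]]; split.
  move=> b x y; rewrite -[LHS]/(a *: f (b *: x + y) + g (b *: x + y)).
  rewrite -[RHS]/(b *: (a *: f x + g x) + (a *: f y + g y)).
  rewrite lf lg !scalerDr !scalerA (mulrC a) !addrA; congr (_ + _).
  by rewrite addrAC.
exists (`|a| * M + N) => s; rewrite mulrDl -mulrA.
apply: le_trans (ler_normD _ _) _; apply: lerD; last exact: gN.
by rewrite normrZ ler_wpM2l.
Qed.

Lemma dual0 : dual (0 : {ptws S -> R[i]^o}).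
Proof.
split; first by move=> a x y; rewrite /= scaler0 addr0.
by exists 0 => s; rewrite normr0 mul0r.
Qed.

(** A functional vanishing on the common kernel of finitely many evaluations is a combination of
    them. The domain [D] is variable so that the induction on [X] can pass to the kernel of one
    evaluation. *)
Lemma eval_kernel (X : seq S) (D : set (S -> R[i]^o))
    (L : (S -> R[i]^o) -> R[i]^o) :
  (forall g, D g -> linear g) ->
  (forall (a : R[i]) f g, D f -> D g -> D (a *: f + g)) ->
  (forall (a : R[i]) f g, D f -> D g -> L (a *: f + g) = a *: L f + L g) ->
  (forall g, D g -> (forall s, s \in X -> g s = 0) -> L g = 0) ->
  exists t, forall g, D g -> L g = g t.
Proof.
move=> Dlin; elim: X D L Dlin => [|s X IH] D L Dlin DP LP ker.
  by exists 0 => g Dg; rewrite (lin0 (Dlin g Dg)); exact: ker.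
have [t' t'P] : exists t, forall g, D g /\ g s = 0 -> L g = g t.
  apply: (IH [set g | D g /\ g s = 0]).
  - by move=> g [/Dlin].
  - move=> a f g [Df fs] [Dg gs]; split; first exact: DP.
    by rewrite -[LHS]/(a *: f s + g s) fs gs scaler0 addr0.
  - by move=> a f g [Df _] [Dg _]; exact: LP.
  - move=> g [Dg gs] gX; apply: ker => // x.
    by rewrite inE => /predU1P[->|/gX].
have [[v Dv vs]|nov] := pselect (exists2 v, D v & v s != 0); last first.
  exists t' => g Dg; apply: t'P; split=> //; apply/eqP/negPn/negP => gs.
  by apply: nov; exists g.
(* [L] and evaluation at [t'] agree where evaluation at [s] vanishes, so they differ by a multiple
   of the latter; [v] determines the factor. *)
pose c := (v s)^-1 * (L v - v t'); exists (t' + c *: s) => g Dg.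
have [h hE] : exists h, h = (- (g s / v s)) *: v + g by eexists.
have Dh : D h by rewrite hE; exact: DP.
have hs : h s = 0.
  rewrite hE -[LHS]/(- (g s / v s) * v s + g s).
  by rewrite mulNr divfK // addNr.
have := t'P h (conj Dh hs); rewrite hE LP //.
rewrite -[RHS]/(- (g s / v s) * v t' + g t').
rewrite -[X in X -> _]/(- (g s / v s) * L v + L g = _).
rewrite (linD (Dlin g Dg)) (linZ (Dlin g Dg)) => e.
have : L g = g s / v s * L v + (- (g s / v s) * v t' + g t').
  by rewrite -e; ring.
move=> ->; rewrite -[c *: g s]/(c * g s) /c; ring.
Qed.

Variables (a : {ptws S -> R[i]^o} -> R) (a_wstar : affine_wstar a).

(** The real-linear part of [a]. The affine identity is given for $0 \le t \le 1$; larger $t$ are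
    reached through $t^{-1}$, sums as midpoints of $2f$ and $2g$, and negative factors by
    additivity. *)
Let l (f : S -> R[i]^o) : R := a f - a 0.

Let D (f : S -> R[i]^o) := dual (f : {ptws S -> R[i]^o}).

Let DZ (b : R[i]) f : D f -> D (b *: f).
Proof. by move=> Df; rewrite -[b *: f]addr0; apply: dualP => //;
  exact: dual0. Qed.

Let l_conv f g (t : R) : D f -> D g -> 0 <= t <= 1 ->
  l (t%:C *: f + (1 - t)%:C *: g) = t * l f + (1 - t) * l g.
Proof.
move=> Df Dg t01; rewrite /l (a_wstar.2 f g t Df Dg t01); ring.
Qed.

Let l0 : l 0 = 0. Proof. exact: subrr. Qed.

Let l_small f (t : R) : D f -> 0 <= t <= 1 -> l (t%:C *: f) = t * l f.
Proof.
move=> Df t01; have := l_conv Df dual0 t01.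
by rewrite scaler0 addr0 l0 mulr0 addr0.
Qed.

Let l_pos f (t : R) : D f -> 0 <= t -> l (t%:C *: f) = t * l f.
Proof.
move=> Df t0; have [t1|t1] := leP t 1; first by rewrite l_small ?t0.
have t0' : 0 < t by exact: lt_trans ltr01 t1.
have tn : t != 0 by rewrite gt_eqF.
have := @l_small (t%:C *: f) t^-1 (DZ _ Df).
rewrite invr_ge0 t0 invf_le1 // (ltW t1) scalerA -rmorphM /= mulVf // scale1r.
by move=> /(_ isT) ->; rewrite mulrA mulfV // mul1r.
Qed.

Let lD f g : D f -> D g -> l (f + g) = l f + l g.
Proof.
move=> Df Dg.
have h : 0 <= (2^-1 : R) <= 1 by lra.
have := l_conv (DZ 2%:C Df) (DZ 2%:C Dg) h.
rewrite (_ : 1 - 2^-1 = 2^-1); last by lra.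
rewrite !scalerA -rmorphM /= mulVf ?pnatr_eq0 // !scale1r => ->.
by rewrite !l_pos //; field.
Qed.

Let lN f : D f -> l (- f) = - l f.
Proof.
move=> Df; have DN : D (- f) by rewrite -scaleN1r; exact: DZ.
by have := lD Df DN; rewrite subrr l0 => /eqP;
  rewrite eq_sym addrC addr_eq0 => /eqP.
Qed.

Let lZ f (t : R) : D f -> l (t%:C *: f) = t * l f.
Proof.
move=> Df; have [t0|t0] := leP 0 t; first exact: l_pos.
have -> : t%:C *: f = - ((- t)%:C *: f) by rewrite rmorphN scaleNr opprK.
rewrite lN; last exact: DZ.
by rewrite l_pos ?oppr_ge0 ?(ltW t0) // mulNr opprK.
Qed.

(** Continuity at 0 gives a finite box around 0 on which $|l| < 1$. The common kernel of its
    coordinates is a subspace inside the box, so [l] vanishes there, and [eval_kernel] applies to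
    the complexification of [l]. *)
Lemma affine_wstarE : exists (t : S) (c : R),
  forall f, dual (f : {ptws S -> R[i]^o}) -> a f = complex.Re (f t) + c.
Proof.
have [X [e [e0 aX]]] : exists (X : seq S) (e : R), 0 < e /\ forall g, D g ->
    (forall s, s \in X -> rnorm (g s : R[i]^o) <= e) -> `|l g| < 1.
  have /subspace_continuousP/(_ _ dual0)/cvgrPdist_lt/(_ 1 ltr01) := a_wstar.1.
  rewrite /within /= => /ptws_nbhs_basis[X [e [e0 h]]]; exists X, e;
    split=> // g Dg gX.
  have := h g; rewrite distrC; apply=> // s sX.
  by rewrite subr0; exact: gX.
have ker g : D g -> (forall s, s \in X -> g s = 0) -> l g = 0.
  move=> Dg gX; apply/eqP/negPn/negP => lg.
  have := aX (((l g)^-1)%:C *: g) (DZ _ Dg).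
  rewrite lZ // mulVf // normr1 ltxx => /(_ _)/notF; apply=> s sX.
  by rewrite -[X in rnorm X]/(_ *: g s) gX // scaler0 rnorm0 ltW.
(* The complex-linear functional whose real part is [l]. *)
pose L (f : S -> R[i]^o) : R[i]^o := (l f)%:C - 'i * (l ('i *: f))%:C.
have ii f : 'i *: ('i *: f) = - f :> (S -> R[i]^o).
  by rewrite scalerA -expr2 sqrCi scaleN1r.
have LE f g (b : R[i]) : D f -> D g -> L (b *: f + g) = b *: L f + L g.
  move=> Df Dg; have [x [y ->]] : exists x y : R, b = x%:C + 'i * y%:C.
    exists (complex.Re b), (complex.Im b).
    by rewrite [LHS]complexE.
  have lb h : D h -> l ((x%:C + 'i * y%:C) *: h) = x * l h + y * l ('i *: h).
    move=> Dh; rewrite scalerDl mulrC -scalerA lD ?lZ //; try exact: DZ.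
    exact/DZ/DZ.
  set z := x%:C + 'i * y%:C in lb *.
  have -> : L (z *: f + g) = (l (z *: f + g))%:C - 'i * (l (z *: ('i *: f) +
    'i *: g))%:C.
    have sw : 'i *: (z *: f) = z *: ('i *: f) by rewrite !scalerA mulrC.
    by rewrite /L scalerDr sw.
  have D1 : D ('i *: f) := DZ _ Df; have D2 : D ('i *: g) := DZ _ Dg.
  have D3 : D (z *: f) := DZ _ Df; have D4 : D (z *: ('i *: f)) := DZ _ D1.
  rewrite !lD // !lb // ii lN //.
  rewrite -[X in _ = X + _]/(z * L f) /L /z.
  move: (l f) (l ('i *: f)) (l g) (l ('i *: g)) => l1 l2 l3 l4.
  rewrite !(rmorphD, rmorphN, rmorphM) /=.
  have : 'i * 'i = -1 :> R[i] by rewrite -expr2 sqrCi.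
  set I := 'i => I2.
  apply/eqP; rewrite -subr_eq0; apply/eqP.
  rewrite (_ : _ - _ = (I * I + 1) * y%:C * l2%:C); last by ring.
  by rewrite I2 addNr !mul0r.
have [t tP] : exists t, forall g, D g -> L g = g t.
  apply: (@eval_kernel X [set g | D g] L) => //.
  - by move=> g [].
  - by move=> b f g; exact: dualP.
  - by move=> b f g; exact: LE.
  - move=> g Dg gX; rewrite /L ker // ker ?mulr0 ?subr0 //; first exact: DZ.
    by move=> s sX; rewrite -[LHS]/('i *: g s) gX // scaler0.
exists t, (a 0) => f Df; rewrite -(tP f Df) /L.
rewrite (_ : complex.Re _ = l f); first by rewrite subrK.
by simpc.
Qed.

End WeakStarFunctionals.

(** * Continuous convex functions on the state space *)

Section UniformClosure.
Variables (R : realType) (T : choiceType).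

Lemma uniform_closureP (G : set (T -> R[i]^o)) (f : T -> R[i]^o) :
  closure (G : set {uniform T -> R[i]^o}) f <->
  forall e : R, 0 < e -> exists2 g, G g & forall x, rnorm (f x - g x) <= e.
Proof.
split=> [clf e e0|h B /uniform_nbhs[E [entE EB]]].
  have [g [Gg fg]] : G `&` [set h | forall x, rnorm (f x - h x) <= e] !=set0.
    apply: clf; apply/uniform_nbhs.
    exists [set p : R[i]^o * R[i]^o | rnorm (p.1 - p.2) <= e]; split.
      rewrite -entourage_ballE; exists e%:C; first by rewrite /= (ltcR 0 e).
      by move=> [x y] /=; rewrite -ball_normE /= rnormE ltcR => /ltW.
    by move=> h hh x; apply: hh.
  by exists g.
move: entE; rewrite -entourage_ballE => -[e /= e0 eE].
have [r re] : exists r, e = r%:C by apply/complex_realP; exact: gtr0_real.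
have r0 : 0 < r by rewrite -ltcR -re.
have r20 : 0 < r / 2 by rewrite divr_gt0.
have [g Gg fg] := h _ r20.
exists g; split=> //; apply: EB => x _; apply: eE => /=.
rewrite -ball_normE /= rnormE re ltcR.
by apply: le_lt_trans (fg x) _; rewrite ltr_pdivrMr // ltr_pMr // ltr1n.
Qed.

End UniformClosure.

Section RealFunctions.
Variables (R : realType) (T : topologicalType).

Definition cfun (F : T -> R) : T -> R[i]^o := fun x => (F x)%:C.

Lemma rnorm_real (a : R) : rnorm (a%:C : R[i]^o) = `|a|.
Proof. by rewrite /rnorm normc_def /= expr0n addr0 sqrtr_sqr. Qed.

Lemma cfun_continuous (F : T -> R) : continuous (cfun F) <-> continuous F.
Proof.
split=> cF x.
  apply/cvgrPdist_le => e e0.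
  have e0' : 0 < e%:C by rewrite (ltcR 0 e).
  have /(_ _ e%:C e0') := iffLR (cvgrPdist_le _ _) (cF x).
  apply: filterS => y; rewrite rnormE lecR /cfun.
  by rewrite -[X in rnorm X]/(_%:C - _%:C) -rmorphB rnorm_real.
apply/cvgrPdist_le => e e0.
have [r re] : exists r, e = r%:C by apply/complex_realP; exact: gtr0_real.
have r0 : 0 < r by rewrite -ltcR -re.
have /(_ _ r r0) := iffLR (cvgrPdist_le _ _) (cF x).
apply: filterS => y; rewrite re rnormE lecR /cfun => h.
by rewrite -[X in rnorm X]/(_%:C - _%:C) -rmorphB rnorm_real.
Qed.

Lemma ReB_le (z w : R[i]^o) : `|complex.Re z - complex.Re w| <= rnorm (z - w).
Proof.
have -> : complex.Re z - complex.Re w = complex.Re (z - w)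
  by case: z w => [a b] [c d].
by rewrite -lecR -rnormE; exact: normc_ge_Re.
Qed.

Lemma rnorm_le_ReIm (z : R[i]^o) : rnorm z <= `|complex.Re z| + `|complex.Im z|.
Proof.
case: z => a b; rewrite /rnorm normc_def /=.
rewrite -(@ler_pXn2r _ 2) ?nnegrE ?sqrtr_ge0 ?addr_ge0 //.
rewrite sqr_sqrtr ?addr_ge0 ?sqr_ge0 // sqrrD !real_normK ?num_real //.
by rewrite addrAC lerDl mulrn_wge0 // mulr_ge0.
Qed.

Lemma Re_continuous (f : T -> R[i]^o) : continuous f ->
  continuous (fun x => complex.Re (f x)).
Proof.
move=> cf x; apply/cvgrPdist_le => e e0.
have e0' : 0 < e%:C by rewrite (ltcR 0 e).
have /(_ _ e%:C e0') := iffLR (cvgrPdist_le _ _) (cf x).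
by apply: filterS => y; rewrite rnormE lecR; exact: le_trans (ReB_le _ _).
Qed.

Lemma max_cfun (F G : T -> R) :
  (fun x => Num.max (cfun F x) (cfun G x)) = cfun (fun x =>
    Num.max (F x) (G x)).
Proof.
apply/funext => x; rewrite /cfun /Num.max -[(_ < _)%R in LHS]/((F x)%:C < (G
  x)%:C) ltcR.
by case: ltP.
Qed.

Lemma max_continuous (F G : T -> R) : continuous F -> continuous G ->
  continuous (fun x => Num.max (F x) (G x)).
Proof. by move=> cF cG x; exact: (continuous_max (cF x) (cG x)). Qed.

Lemma real_cst_continuous (c : R) : continuous (fun _ : T => c).
Proof. exact: cst_continuous. Qed.

Lemma real_add_continuous (F G : T -> R) : continuous F -> continuous G ->
  continuous (fun x => F x + G x).
Proof. by move=> cF cG x; exact: cvgD (cF x) (cG x). Qed.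

Lemma real_shift_continuous (F : T -> R) (c : R) : continuous F ->
  continuous (fun x => F x + c).
Proof.
by move=> cF; apply: (@real_add_continuous F (fun=> c)) => //;
  exact: real_cst_continuous.
Qed.

Lemma real_sqr_continuous (F : T -> R) : continuous F ->
  continuous (fun x => F x ^+ 2).
Proof. by move=> cF x; exact: cvgM (cF x) (cF x). Qed.

Lemma real_sum_continuous (I : Type) (r : seq I) (F : I -> T -> R) :
  (forall i, continuous (F i)) -> continuous (fun x => \sum_(i <- r) F i x).
Proof.
move=> cF; elim: r => [|i r IH].
  rewrite (_ : (fun _ => _) = fun=> 0); first exact: real_cst_continuous.
  by apply/funext => x; rewrite big_nil.
rewrite (_ : (fun _ => _) = fun x => F i x + \sum_(i <- r) F i x).
  exact: real_add_continuous.
by apply/funext => x; rewrite big_cons.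
Qed.

End RealFunctions.

Section Gamma.
Variables (R : realType) (S : opsys R).
Implicit Types f g : state_space S -> R[i]^o.

(** The combination is named by a third state [chi], since a sum of states is not itself a term of
    the subtype. *)
Definition state_convex (F : state_space S -> R) :=
  forall (phi psi chi : state_space S) (t : R), 0 <= t <= 1 ->
    set_val chi = t%:C *: (set_val phi : S -> R[i]^o)
                  + (1 - t)%:C *: (set_val psi : S -> R[i]^o) ->
    F chi <= t * F phi + (1 - t) * F psi.

Lemma GammaP f : Gamma f <->
  exists F, [/\ f = cfun F, continuous F & state_convex F].
Proof.
split=> [[[cf realf] convf]|[F [-> cF convF]]].
  have fE : f = cfun (fun x => complex.Re (f x)).
    by apply/funext => x; rewrite /cfun RRe_real.
  exists (fun x => complex.Re (f x)); split=> //.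
    by apply/cfun_continuous; rewrite -fE.
  move=> phi psi chi t t01 /(convf _ _ _ _ t01).
  by rewrite fE /cfun /= -!rmorphM -rmorphD lecR.
split; first split.
- exact/cfun_continuous.
- by move=> x; rewrite complex_real.
move=> phi psi chi t t01 /(convF _ _ _ _ t01).
by rewrite /cfun -!rmorphM -rmorphD lecR.
Qed.

Lemma Gamma_closed_max_cone : closed_max_cone (@Gamma R S).
Proof.
split.
- by move=> f [].
- move=> _ _ /GammaP[F [-> cF convF]] /GammaP[G [-> cG convG]].
  apply/GammaP; exists (F \+ G); split.
  + by apply/funext => x; rewrite /cfun /= rmorphD.
  + by move=> x; exact: cvgD (cF x) (cG x).
  + move=> phi psi chi t t01 h /=.
    by have := convF _ _ _ _ t01 h; have := convG _ _ _ _ t01 h; lra.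
- move=> c _ c0 /GammaP[F [-> cF convF]]; apply/GammaP.
  exists (fun x => c * F x); split.
  + by apply/funext => x; rewrite /cfun rmorphM.
  + by move=> x; exact: cvgM (cvg_cst c) (cF x).
  + move=> phi psi chi t t01 h /=.
    by have := convF _ _ _ _ t01 h; move/(ler_wpM2l c0); lra.
- move=> _ _ /GammaP[F [-> cF convF]] /GammaP[G [-> cG convG]].
  rewrite max_cfun; apply/GammaP; exists (fun x => Num.max (F x) (G x));
    split=> //.
  + exact: max_continuous.
  + move=> phi psi chi t /andP[t0 t1] h /=.
    have h1 : F chi <= t * F phi + (1 - t) * F psi by apply: convF => //;
      rewrite t0.
    have h2 : G chi <= t * G phi + (1 - t) * G psi by apply: convG => //;
      rewrite t0.
    have t1' : 0 <= 1 - t by lra.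
    have m1 : F phi <= Num.max (F phi) (G phi) by rewrite le_max lexx.
    have m2 : G phi <= Num.max (F phi) (G phi) by rewrite le_max lexx orbT.
    have m3 : F psi <= Num.max (F psi) (G psi) by rewrite le_max lexx.
    have m4 : G psi <= Num.max (F psi) (G psi) by rewrite le_max lexx orbT.
    rewrite ge_max; apply/andP; split; nra.
- move=> f [cf /uniform_closureP clf].
  have realf x : complex.Im (f x) = 0.
    apply/eqP; rewrite -normr_eq0 eq_le normr_ge0 andbT.
    apply: (@le0_linear_bound _ 1) => e e0; rewrite mul1r.
    have [_ /GammaP[F [-> _ _]] /(_ x) fF] := clf e e0.
    apply: le_trans fF; case: (f x) => a b.
    rewrite /cfun /rnorm normc_def /= subr0.
    rewrite -(@ler_pXn2r _ 2) ?nnegrE ?sqrtr_ge0 // sqr_sqrtr ?addr_ge0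
      ?sqr_ge0 //.
    by rewrite real_normK ?num_real // lerDr sqr_ge0.
  apply/GammaP; exists (fun x => complex.Re (f x)).
  have fE : f = cfun (fun x => complex.Re (f x)).
    by apply/funext => x; rewrite /cfun [LHS]complexE realf mulr0 addr0.
  split=> //; first exact: Re_continuous.
  move=> phi psi chi t t01 h.
  (* One [e] is lost at [chi], and one in the convex combination of the values at [phi] and
     [psi]. *)
  rewrite -subr_le0; apply: (@le0_linear_bound _ 2) => e e0.
  have [_ /GammaP[F [-> _ convF]] fF] := clf e e0.
  have b x : `|complex.Re (f x) - F x| <= e
    by apply: le_trans (ReB_le (f x) (cfun F x)) (fF x).
  have := b phi; have := b psi; have := b chi; have := convF _ _ _ _ t01 h.
  rewrite !ler_norml => c /andP[c1 c2] /andP[p1 p2] /andP[q1 q2].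
  case/andP: t01 => t0 t1; nra.
Qed.

Lemma state_convexity (phi psi : state_space S) (t : R) : 0 <= t <= 1 ->
  exists chi : state_space S,
    set_val chi = t%:C *: (set_val phi : S -> R[i]^o)
                  + (1 - t)%:C *: (set_val psi : S -> R[i]^o).
Proof.
move=> /andP[t0 t1].
pose g : {ptws S -> R[i]^o} := t%:C *: (set_val phi : S -> R[i]^o)
                  + (1 - t)%:C *: (set_val psi : S -> R[i]^o).
suff sg : states g by exists (SigSub (mem_set sg)).
have [l1 o1 p1] : states (set_val phi) := set_valP phi.
have [l2 o2 p2] : states (set_val psi) := set_valP psi.
have gE s : g s = t%:C * set_val phi s + (1 - t)%:C * set_val psi s by [].
split.
- move=> a x y; rewrite !gE l1 l2 -[RHS]/(a * (g x) + g y) !gE.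
  rewrite -![_ *: _]/(_ * _); ring.
- by rewrite gE o1 o2 !mulr1 -rmorphD addrC subrK.
- move=> s hs; rewrite gE; apply: addr_ge0; apply: mulr_ge0;
    rewrite ?ler0c ?subr_ge0 //; [exact: p1 | exact: p2].
Qed.

(** The Banach-Alaoglu argument: [state_bound] puts the states into a product of compact squares.
    They are closed there because each defining condition involves finitely many values, which
    [near_f] approximates simultaneously. *)
Lemma states_compact : compact (@states R S).
Proof.
pose K (r : R) := (fun p : R * R => p.1%:C + 'i * p.2%:C : R[i]^o) @`
  (`[- r, r] `*` `[- r, r]).
have cK r : compact (K r).
  apply: continuous_compact; last by apply: compact_setX;
    exact: segment_compact.
  apply: continuous_subspaceT => p; apply/cvgrPdist_le => e e0.
  have [d de] : exists d, e = d%:C by apply/complex_realP; exact: gtr0_real.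
  have d0 : 0 < d by rewrite -ltcR -de.
  have d20 : 0 < d / 2 by rewrite divr_gt0.
  have f1 : (fst : R * R -> R) @ p --> p.1 by exact: cvg_fst.
  have f2 : (snd : R * R -> R) @ p --> p.2 by exact: cvg_snd.
  have /(_ _ _ d20) n1 := iffLR (cvgrPdist_le _ _) f1.
  have /(_ _ _ d20) n2 := iffLR (cvgrPdist_le _ _) f2.
  apply: (@filterS _ (nbhs p) _ _ _ _ (filterI n1 n2)) => q [h1 h2].
  rewrite de rnormE lecR; apply: le_trans (rnorm_le_ReIm _) _.
  have -> : p.1%:C + 'i * p.2%:C - (q.1%:C + 'i * q.2%:C) =
      (p.1 - q.1) +i* (p.2 - q.2) :> R[i]^o.
    by simpc.
  by rewrite /= [leRHS]splitr lerD.
have cT : compact [set f : {ptws S -> R[i]^o} | forall s,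
  K (2 * rnorm (os_emb S s)) (f s)].
  exact: (@tychonoff S (fun _ => R[i]^o) (fun s =>
    K (2 * rnorm (os_emb S s))) (fun s => cK _)).
apply: (subclosed_compact _ cT); last first.
  move=> f sf s /=; exists (complex.Re (f s), complex.Im (f s)).
    2: by exact/esym/(complexE (f s : R[i])).
  split; rewrite /= in_itv /= -ler_norml; apply: le_trans (state_bound s sf).
    by have := ReB_le (f s) 0; rewrite !subr0.
  case: (f s) => a b; rewrite /rnorm normc_def /=.
  rewrite -(@ler_pXn2r _ 2) ?nnegrE ?sqrtr_ge0 // sqr_sqrtr ?addr_ge0 ?sqr_ge0
    //.
  by rewrite real_normK ?num_real // lerDr sqr_ge0.
move=> f clf.
have near_f (X : seq S) (e : R) : 0 < e -> exists2 g : {ptws S -> R[i]^o},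
  states g &
    forall s, s \in X -> rnorm (g s - f s : R[i]^o) <= e.
  move=> e0; have : nbhs f [set g : {ptws S -> R[i]^o} |
      forall s, s \in X -> rnorm (g s - f s : R[i]^o) <= e].
    elim: X => [|s X IH]; first by apply: filterS filterT.
    apply: filterS (filterI (ptws_nbhs_eval f s e0) IH) => g [/= gs gX] t.
    by rewrite inE => /predU1P[->|/gX].
  by move/clf => [g [sg gX]]; exists g.
split.
- move=> a x y; apply: (@rnorm_eq_small _ _ (2 + complex.Re `|a|)) => e e0.
  have [g [lg _ _] gX] := near_f [:: a *: x + y; x; y] e e0.
  have := lg a x y; move: (gX (a *: x + y)) (gX x) (gX y).
  rewrite !inE !eqxx !orbT => /(_ isT) h1 /(_ isT) h2 /(_ isT) h3 gE.
  have -> : f (a *: x + y) - (a *: f x + f y) =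
     - (g (a *: x + y) - f (a *: x + y)) + (a *: (g x - f x) + (g y - f y)).
    by rewrite gE scalerBr -[a *: f x]/(a * f x) -[a *: g x]/(a * g x); ring.
  apply: le_trans (rnormD _ _) _; rewrite rnormN.
  have := rnormD (a *: (g x - f x)) (g y - f y); rewrite rnormZ.
  have a0 : 0 <= complex.Re `|a|
    by rewrite -[complex.Re _]/(rnorm (a : R[i]^o)) rnorm_ge0.
  have : complex.Re `|a| * rnorm (g x - f x) <= complex.Re `|a| * e
    by rewrite ler_wpM2l.
  lra.
- apply: (@rnorm_eq_small _ _ 1) => e e0; rewrite mul1r.
  have [g [_ <- _] gX] := near_f [:: os_one S] e e0.
  by rewrite rnormB; apply: gX; rewrite inE.
- move=> s ps; have rp (g : {ptws S -> R[i]^o}) : states g -> 0 <= g s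
  by case=> _ _; apply.
  (* The order of [R[i]] includes reality, so the imaginary part is disposed of before the sign. *)
  have -> : f s = (complex.Re (f s))%:C.
    apply: (@rnorm_eq_small _ _ 2) => e e0.
    have [g sg gX] := near_f [:: s] e e0.
    have := gX s; rewrite inE eqxx => /(_ isT) h.
    have gr := ger0_real (rp g sg).
    apply: le_trans (rnormBD _ (g s) _) _.
    rewrite -{2}(RRe_real gr) -[X in _ + rnorm X]/(_%:C - _%:C) -rmorphB
      rnorm_real.
    by have := ReB_le (g s) (f s); rewrite (rnormB (f s)); lra.
  rewrite ler0c -oppr_le0; apply: (@le0_linear_bound _ 1) => e e0;
    rewrite mul1r.
  have [g sg gX] := near_f [:: s] e e0.
  have := gX s; rewrite inE eqxx => /(_ isT) h.
  have := ReB_le (g s) (f s); rewrite ler_norml => /andP[_ h2].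
  have : 0 <= complex.Re (g s).
    by rewrite -ler0c RRe_real ?ger0_real ?rp.
  lra.
Qed.

Lemma state_space_compact : compact [set: state_space S].
Proof.
move=> F PF _.
have FS : (set_val @ F) (@states R S).
  by apply: (@filterE _ F) => x; exact: set_valP.
have [p [sp clp]] := states_compact (fmap_proper_filter _ PF) FS.
exists (SigSub (mem_set sp)); split=> // A B FA [_ [[V oV <-] /= Vp VB]].
have FA' : (set_val @ F) (set_val @` A).
  by apply: (@filterS _ F _ A) => // x Ax; exists x.
have [_ [[x Ax <-] Vx]] := clp _ _ FA' (open_nbhs_nbhs (conj oV Vp)).
by exists x; split=> //; apply: VB.
Qed.

End Gamma.

(** * Affine minorants of convex functions and uniform approximation by their maxima *)

Section AffineMinorants.
Variables (R : realType) (S : opsys R).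
Local Notation L := (state_space S).

Definition re_eval (s : S) (phi : L) : R := complex.Re (state_eval s phi).

Lemma state_eval_continuous s : continuous (@state_eval R S s).
Proof.
move=> phi.
have h1 : continuous (set_val : L -> {ptws S -> R[i]^o})
  by exact: initial_continuous.
have h2 : continuous (fun f : {ptws S -> R[i]^o} => f s : R[i]^o).
  exact: (@proj_continuous S (fun _ => R[i]^o) s).
exact: continuous_comp (h1 phi) (h2 _).
Qed.

Lemma re_eval_continuous s : continuous (re_eval s).
Proof. by apply: Re_continuous; exact: state_eval_continuous. Qed.

Lemma re_eval_affine s (phi psi chi : L) (t : R) :
  set_val chi = t%:C *: (set_val phi : S -> R[i]^o)
                + (1 - t)%:C *: (set_val psi : S -> R[i]^o) ->
  re_eval s chi = t * re_eval s phi + (1 - t) * re_eval s psi.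
Proof.
move=> h; rewrite /re_eval /state_eval h.
rewrite -[X in complex.Re X]/(t%:C * set_val phi s + (1 - t)%:C * set_val psi
  s).
by case: (set_val phi s) (set_val psi s) => [a b] [c d]; simpc.
Qed.

Lemma re_eval_sum (X : seq S) (c : S -> R) (phi : L) :
  re_eval (\sum_(s <- X) (c s)%:C *: s) phi = \sum_(s <- X) c s * re_eval s phi.
Proof.
have lin := state_linear (state_spaceP phi).
rewrite /re_eval /state_eval (lin_sum lin).
rewrite (@big_morph _ _ (@complex.Re R) 0 +%R 0 +%R) //;
  last by move=> [a b] [a' b'].
apply: eq_bigr => s _; rewrite (linZ lin).
rewrite -[X in complex.Re X]/((c s)%:C * set_val phi s).
by case: (set_val phi s) => a b; simpc.
Qed.

(** Real parts suffice: the imaginary part of $f(s)$ is the real part of $f(-is)$, so the finite set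
    is enlarged by the elements $-is$. *)
Lemma state_space_nbhs_basis (phi : L) (A : set L) : nbhs phi A ->
  exists (X : seq S) (d : R), 0 < d /\ forall psi : L,
    (forall s, s \in X -> `|re_eval s psi - re_eval s phi| <= d) -> A psi.
Proof.
move=> [_ [[V oV <-] /= Vp VA]].
have [X [d [d0 XV]]] := ptws_nbhs_basis (open_nbhs_nbhs (conj oV Vp)).
exists (X ++ [seq - 'i *: s | s <- X]), (d / 2); split;
  first by rewrite divr_gt0.
move=> psi h; apply/VA/XV => s sX.
apply: le_trans (rnorm_le_ReIm _) _; rewrite [leRHS]splitr.
have imE (f : L) : complex.Im (set_val f s) = re_eval (- 'i *: s) f.
  rewrite /re_eval /state_eval (linZ (state_linear (state_spaceP f))).
  rewrite -[X in complex.Re X]/(- 'i * set_val f s).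
  by case: (set_val f s) => a b; simpc.
have ReB (z w : R[i]^o) : complex.Re (z - w) = complex.Re z - complex.Re w.
  by case: z w => [a b] [a' b'].
have ImB (z w : R[i]^o) : complex.Im (z - w) = complex.Im z - complex.Im w.
  by case: z w => [a b] [a' b'].
apply: lerD; first by rewrite ReB; apply: h; rewrite mem_cat sX.
by rewrite ImB !imE; apply: h; rewrite mem_cat map_f ?orbT.
Qed.

(** Both sides agree at $t = 0$, so the derivative $2(Q - P)$ of the right side there is
    nonnegative. *)
Lemma quadratic_slope (P Q W : R) :
  (forall t, 0 <= t <= 1 -> P <= (1 - t) ^+ 2 * P + 2 * (t * (1 - t)) * Q + t
    ^+ 2 * W) ->
  P <= Q.
Proof.
move=> h; rewrite -subr_le0.
apply: (@le0_linear_bound _ (`|P| + 2 * `|Q| + `|W|)) => e e0.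
pose t := Num.min e 1.
have t0 : 0 < t by rewrite lt_min e0 ltr01.
have t1 : t <= 1 by rewrite ge_min lexx orbT.
have te : t <= e by rewrite ge_min lexx.
have := h t; rewrite (ltW t0) t1 => /(_ isT) ht.
have h2 : 2 * (P - Q) <= t * (P - 2 * Q + W).
  rewrite -(ler_pM2l t0); nra.
have h3 : P - 2 * Q + W <= `|P| + 2 * `|Q| + `|W|.
  by have := ler_norm P; have := ler_norm (- Q); have := ler_norm W;
    rewrite normrN; lra.
have k0 : 0 <= `|P| + 2 * `|Q| + `|W| by rewrite !addr_ge0 // mulr_ge0.
have h4 : t * (P - 2 * Q + W) <= t * (`|P| + 2 * `|Q| + `|W|)
  by rewrite ler_wpM2l // ltW.
have h5 : t * (`|P| + 2 * `|Q| + `|W|) <= e * (`|P| + 2 * `|Q| + `|W|).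
  by rewrite ler_wpM2r.
have h6 : 0 <= e * (`|P| + 2 * `|Q| + `|W|) by rewrite mulr_ge0 // ltW.
lra.
Qed.

(* The separating functional is the gradient, at its minimum phi1 on L, of
   phi |-> \sum_s (Re phi(s) - Re phi0(s))^2 + max(0, F phi - F phi0 + e)^2. *)
Lemma convex_affine_minorant (F : L -> R) (phi0 : L) (e : R) :
  continuous F -> state_convex F -> 0 < e ->
  exists (s : S) (c : R), (forall phi, re_eval s phi + c < F phi) /\
    re_eval s phi0 + c = F phi0 - e.
Proof.
move=> cF convF e0; pose p := F phi0 - e.
have [X [d [d0 Xd]]] : exists (X : seq S) (d : R), 0 < d /\ forall psi : L,
    (forall s, s \in X -> `|re_eval s psi - re_eval s phi0| <= d) -> p < F psi.
  apply: state_space_nbhs_basis.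
  have /(_ _ _ e0) := iffLR (cvgrPdist_lt _ _) (cF phi0).
  by apply: filterS => psi; rewrite ltr_norml /p; lra.
pose u s phi := re_eval s phi - re_eval s phi0.
pose v phi := Num.max 0 (F phi - p).
(* In the coordinates [X], this is the squared distance from the point over [phi0] at height [p] to
   the part of the epigraph of [F] over [phi]. It is positive: either some coordinate differs by
   more than [d], or [F] exceeds [p]. *)
pose G phi := \sum_(s <- X) u s phi ^+ 2 + v phi ^+ 2.
have cu s : continuous (u s).
  apply: real_shift_continuous; exact: re_eval_continuous.
have cv : continuous v.
  apply: max_continuous; first exact: real_cst_continuous.
  exact: real_shift_continuous.
have cG : continuous G.
  apply: real_add_continuous; last exact: real_sqr_continuous.
  by apply: real_sum_continuous => s; exact: real_sqr_continuous.
have [phi1 _ Gmin] : exists2 c, c \in [set: L] & forall t,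
  t \in [set: L] -> G c <= G t.
  apply: compact_EVT_min; [by exists phi0 | exact: state_space_compact |].
  exact: continuous_subspaceT.
have u20 s phi : 0 <= u s phi ^+ 2 by exact: sqr_ge0.
have sum0 phi : 0 <= \sum_(s <- X) u s phi ^+ 2 by exact: sumr_ge0.
have P0 : 0 < G phi1.
  have [h|/existsNP[s /not_implyP[sX sd]]] :=
    pselect (forall s, s \in X -> `|u s phi1| <= d).
    apply: ltr_wpDl => //; rewrite exprn_gt0 // /v lt_max subr_gt0.
    by rewrite (Xd phi1) ?orbT.
  apply: ltr_pwDl; last exact: sqr_ge0.
  rewrite (big_rem s) //=; apply: ltr_pwDl; last exact: sumr_ge0.
  rewrite exprn_even_gt0 //= -normr_gt0; apply: lt_trans d0 _.
  by rewrite ltNge; apply/negP.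
have slope phi : G phi1 <= \sum_(s <- X) u s phi1 * u s phi + v phi1 * (F phi
  - p).
  apply: (@quadratic_slope _ _ (\sum_(s <- X) u s phi ^+ 2 + (F phi - p) ^+
    2)) => t t01.
  have t01' : 0 <= 1 - t <= 1 by case/andP: t01 => ??; lra.
  have [chi chiE] := state_convexity phi1 phi t01'.
  have /Gmin h : chi \in [set: L] by rewrite inE.
  apply: le_trans h _.
  have tt : 1 - (1 - t) = t by rewrite opprB addrC subrK.
  have uE s : u s chi = (1 - t) * u s phi1 + t * u s phi.
    by rewrite /u (re_eval_affine s chiE) tt; ring.
  (* If [F chi] is below [p] the left side is 0; otherwise convexity bounds the positive number
     [F chi - p] by the combination. *)
  have vle : v chi ^+ 2 <= ((1 - t) * v phi1 + t * (F phi - p)) ^+ 2.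
    have := convF _ _ _ _ t01' chiE; rewrite tt => Fc.
    have h1 : F phi1 - p <= v phi1 by rewrite /v le_max lexx orbT.
    have h2 : F chi - p <= (1 - t) * v phi1 + t * (F phi - p).
      by case/andP: t01' => t1 _; have := ler_wpM2l t1 h1; lra.
    rewrite /v; case: (leP 0 (F chi - p)) => h3; last by rewrite expr0n sqr_ge0.
    by apply: lerXn2r => //; rewrite nnegrE // (le_trans h3).
  have -> : (1 - t) ^+ 2 * G phi1 +
      2 * (t * (1 - t)) * (\sum_(s <- X) u s phi1 * u s phi + v phi1 * (F phi
        - p)) +
      t ^+ 2 * (\sum_(s <- X) u s phi ^+ 2 + (F phi - p) ^+ 2) =
      \sum_(s <- X) u s chi ^+ 2 + ((1 - t) * v phi1 + t * (F phi - p)) ^+ 2.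
    have -> : \sum_(s <- X) u s chi ^+ 2 = (1 - t) ^+ 2 * (\sum_(s <- X) u s
      phi1 ^+ 2) +
      2 * (t * (1 - t)) * (\sum_(s <- X) u s phi1 * u s phi) +
      t ^+ 2 * (\sum_(s <- X) u s phi ^+ 2).
      rewrite !mulr_sumr -!big_split /=; apply: eq_bigr => s _.
      by rewrite uE; ring.
    by rewrite /G; ring.
  by rewrite lerD2l.
(* The separating hyperplane is not vertical: at [phi0] all [u s] vanish and [F phi0 - p] is [e], so
   [slope] bounds the positive minimum by [v phi1 * e]. Dividing by [v phi1] then gives the
   minorant. *)
have v0 : 0 < v phi1.
  have := slope phi0; rewrite big1 ?add0r; last first.
    by move=> s _; rewrite /u subrr mulr0.
  rewrite /p opprB addrC subrK => h.
  by rewrite -(pmulr_lgt0 _ e0); exact: lt_le_trans P0 h.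
pose c s := - (u s phi1 / v phi1).
pose t := \sum_(s <- X) (c s)%:C *: s.
have tE phi : re_eval t phi - re_eval t phi0 = - ((\sum_(s <- X) u s phi1 * u
  s phi) / v phi1).
  rewrite !re_eval_sum -sumrB mulr_suml -sumrN; apply: eq_bigr => s _.
  by rewrite /c /u; ring.
exists t, (p - re_eval t phi0); split; last by rewrite addrC subrK.
move=> phi; have := lt_le_trans P0 (slope phi).
rewrite addrCA tE.
rewrite -(pmulr_lgt0 _ (_ : 0 < (v phi1)^-1)) ?invr_gt0 //.
rewrite mulrDl mulrAC mulfV ?gt_eqF // mul1r.
lra.
Qed.

(** Compactness enters as a covering statement for filters: strict minorants in [M], directed under
    pointwise maxima, take the place of a finite subcover, and an eventual minorant is close to [F]
    at all states at once. *)
Lemma Gamma_sub_closed_max_cone (M : set (L -> R[i]^o)) : closed_max_cone M ->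
  (forall s c, M (cfun (fun phi => re_eval s phi + c))) -> @Gamma R S `<=` M.
Proof.
move=> coneM affM f Gf.
have [F [fE cF convF]] := iffLR (GammaP f) Gf.
apply: (cone_closed coneM); split; first by case: Gf => -[].
apply/uniform_closureP => e e0.
(* Over an empty state space any element of [M] approximates; otherwise [phi0] provides the first
   minorant, so that [B] is inhabited. *)
have [[phi0 _]|noL] := pselect (exists phi : L, True); last first.
  exists (cfun (fun phi => re_eval 0 phi + 0)); first exact: affM.
  by move=> phi; case: noL; exists phi.
pose B (h : L -> R) := M (cfun h) /\ forall phi, h phi < F phi.
have minor phi (d : R) : 0 < d -> exists2 h,
  B h & continuous h /\ h phi = F phi - d.
  move=> d0; have [s [c [lt eq]]] := convex_affine_minorant phi cF convF d0.
  exists (fun psi => re_eval s psi + c); first by split=> //; exact: affM.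
  by split=> //; apply: real_shift_continuous; exact: re_eval_continuous.
have [h0 Bh0 _] := minor phi0 1 ltr01.
pose up (h : L -> R) := [set k | B k /\ forall phi, h phi <= k phi].
have Bmax h k : B h -> B k -> B (fun phi => Num.max (h phi) (k phi)).
  move=> [Mh hF] [Mk kF]; split; last by move=> phi; rewrite gt_max hF kF.
  by rewrite -max_cfun; exact: (cone_max coneM).
have FF : Filter (filter_from B up).
  apply: filter_from_filter; first by exists h0.
  move=> h k Bh Bk; exists (fun phi => Num.max (h phi) (k phi));
    first exact: Bmax.
  move=> g [Bg gle]; split; split=> // phi; have := gle phi;
    by rewrite ge_max => /andP[].
have /compact_near_coveringP := @state_space_compact R S.
have e2 : 0 < e / 2 by rewrite divr_gt0.
move=> /(_ (L -> R) (filter_from B up) (fun h phi => F phi - h phi < e) FF).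
case.
  move=> phi _; have [h Bh [ch hE]] := minor phi _ e2.
  have cFh : {for phi, continuous (fun psi => F psi - h psi)}.
    by exact: cvgB (cF phi) (ch phi).
  have /(_ _ _ e2) := iffLR (cvgrPdist_lt _ _) cFh.
  rewrite hE subKr => nF.
  exists ([set psi | F psi - h psi < e], up h) => /=.
    split; last by exists h.
    by apply: filterS nF => psi; rewrite ltr_norml /=; lra.
  by move=> [psi k] /= [Fh [_ /(_ psi)]]; lra.
move=> h Bh hup; exists (cfun h); first by case: Bh.
move=> phi; have hF := Bh.2 phi.
have : F phi - h phi < e by apply: (hup h) => //; split.
rewrite fE /cfun -[X in rnorm X]/(_%:C - _%:C) -rmorphB rnorm_real ger0_norm;
  lra.
Qed.

End AffineMinorants.

Theorem proposition3p5 (R : realType) (S : opsys R) (W : nc_frame S)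
    (Cmax : cstarType R) (j : S -> Cmax)
    (hat : forall n : nc_card W, (S -> nc_sp n -> nc_sp n) ->
           Cmax -> nc_sp n -> nc_sp n)
    (q : Cmax -> state_space S -> R[i]^o) :
  is_max_cover j ->
  (forall (n : nc_card W) (phi : S -> nc_sp n -> nc_sp n), nc_K phi ->
     is_star_rep (hat n phi) /\ forall s, hat n phi (j s) = phi s) ->
  is_star_hom_CL q -> set_surj setT (@CL R S) q ->
  (forall s, q (j s) = state_eval s) ->
  [/\ q @` Xi hat `<=` @Gamma R S,
      forall a : {ptws S -> R[i]^o} -> R, affine_wstar a ->
        (q @` Xi hat) (fun phi => (a (set_val phi))%:C),
      closed_max_cone (@Gamma R S) &
      @Gamma R S = smallest (@closed_max_cone R S) (q @` Xi hat)].
Proof.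
move=> [[_ _ _ jgen] _] hatP qhom _ qj.
have sub : q @` Xi hat `<=` @Gamma R S.
  by move=> _ [b Xb <-]; exact: q_Xi_Gamma jgen hatP qhom qj b Xb.
split=> //.
- move=> a /affine_wstarE[t [c ac]].
  have := q_Xi_affine hatP qj t c; congr (_ _); apply/funext => phi.
  by rewrite ac //; exact/state_dual/state_spaceP.
- exact: Gamma_closed_max_cone.
- apply/seteqP; split.
    move=> f Gf M [coneM qM]; apply: (Gamma_sub_closed_max_cone coneM) Gf.
    by move=> s c; apply/qM/(q_Xi_affine hatP qj).
  by apply: smallest_sub => //; exact: Gamma_closed_max_cone.
Qed.
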